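(* Suppose Assumption 1 holds with constant $\alpha>0$. Then the Bayesian regret of the PS4POMDPs algorithm satisfies $$\mathrm{BReg}(\phi^{\mathrm{PS4POMDPs}},K)\le\tilde{\mathcal O}\Big(\alpha^{-2}H^{2.5}S^2A^{0.5}O^{1.5}\sqrt{(1+SA/O)K}\Big).$$
   Context: A finite-horizon POMDP is a tuple $(\mathscr S,\mathscr A,\mathscr O,H,b_1,T,Z,r)$ with finite state set $\mathscr S$ ($|\mathscr S|=S$), finite action set $\mathscr A$ ($|\mathscr A|=A$), finite observation set $\mathscr O$ ($|\mathscr O|=O$), horizon $H\in\mathbb N$, initial state distribution $b_1\in\Delta(\mathscr S)$, transition kernels $T_h:\mathscr S\times\mathscr A\to\Delta(\mathscr S)$ for $h\in[H-1]$, observation kernels $Z_h:\mathscr S\to\Delta(\mathscr O)$ for $h\in[H]$, and rewards $r_h:\mathscr O\times\mathscr A\to[0,1]$ for $h\in[H]$. A (deterministic) policy $\pi=(\pi_h)_{h=1}^H$ consists of maps $\pi_h:(\mathscr O\times\mathscr A)^{h-1}\times\mathscr O\to\mathscr A$; $\varPi$ is the set of all such policies, and $\pi_h(a\mid\tau_{h-1},o):=\mathbf 1\{\pi_h(\tau_{h-1},o)=a\}$. A trajectory is $\tau=(o_h,a_h)_{h=1}^H\in\mathscr T:=(\mathscr O\times\mathscr A)^H$, and $\tau_h$ denotes its first $h$ observation–action pairs. Its probability under $\pi$ is $\Pr^\pi(\tau)=\pi(\tau)\Pr^-(\tau)$, where $\pi(\tau)=\prod_{h=1}^H\pi_h(a_h\mid\tau_{h-1},o_h)$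 and $\Pr^-(\tau)=\sum_{s_{1:H}\in\mathscr S^H}b_1(s_1)Z_H(o_H\mid s_H)\prod_{h=1}^{H-1}Z_h(o_h\mid s_h)T_h(s_{h+1}\mid s_h,a_h)$. The value of $\pi$ is $V^\pi=\sum_{\tau\in\mathscr T}\Pr^\pi(\tau)\sum_{h=1}^Hr_h(o_h,a_h)$ and $V^*=\max_{\pi\in\varPi}V^\pi$. Learning setting: $\mathscr S,\mathscr A,\mathscr O,H,r$ are known; $(b_1,T,Z)=(b_1^\theta,T^\theta,Z^\theta)$ depends on a parameter $\theta$ in a known Borel parameter set $\varTheta$ via a known measurable parameterization; quantities of the POMDP with parameter $\theta$ carry a subscript $\theta$ ($\Pr^\pi_\theta,\Pr^-_\theta,V^\pi_\theta,V^*_\theta$). The true parameter $\theta^*$ is random with prior $\nu^1\in\Delta(\varTheta)$. In episodes $k=1,2,\dots$, with data $\mathcal D_k=(\tau^j,\pi^j)_{j=1}^{k-1}$, a learning algorithm $\phi=(\phi_k)_k$ draws a policy $\pi^k\sim\phi_k(\mathcal D_k)\in\Delta(\varPi)$, applies it during the whole episode and observes the trajectory $\tau^k\sim\Pr^{\pi^k}_{\theta^*}$. The Bayesian regret over $K$ episodes is $\mathrm{BReg}(\phi,K)=\mathbb E^\phi\big[\sum_{k=1}^K(V^*_{\theta^*}-V^{\pi^k}_{\theta^*})\big]$, the expectation being over $\theta^*\sim\nu^1$, the algorithm's randomness and the trajectories. The PS4POMDPs algorithm: in episode $k$, given the posterior $\nu^k$ ($\nu^1$ = prior), sample $\tilde\theta^k\sim\nu^k$,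 compute (with an exact planner) $\tilde\pi^k\in\arg\max_{\pi\in\varPi}V^\pi_{\tilde\theta^k}$, play $\pi^k=\tilde\pi^k$, observe $\tau^k$, and update by Bayes' rule $\frac{d\nu^{k+1}}{d\nu^k}(\theta)=\Pr^{\tilde\pi^k}_\theta(\tau^k)\big/\int_\varTheta\Pr^{\tilde\pi^k}_{\theta'}(\tau^k)\,d\nu^k(\theta')$. For $\theta\in\varTheta$ and $h\in[H]$, $\mathbb Z_h^\theta$ is the $O\times S$ matrix with entries $\mathbb Z_h^\theta(o,s)=Z_h^\theta(o\mid s)$. Assumption 1 (undercomplete, $\alpha$-weakly revealing): $O\ge S$, and for all $\theta\in\varTheta$ and all $h\in[H]$ the smallest singular value satisfies $\sigma_{\min}(\mathbb Z_h^\theta)\ge\alpha$. $\tilde{\mathcal O}(\cdot)$ hides absolute constants and logarithmic factors in the problem parameters. *)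

(* Defs.v *)
From HB Require Import structures.
From mathcomp Require Import all_boot all_order all_algebra.
From mathcomp Require Import all_classical all_reals all_analysis.

Set Implicit Arguments.
Unset Strict Implicit.
Unset Printing Implicit Defensive.

Import Order.TTheory GRing.Theory Num.Theory.
Import numFieldNormedType.Exports.

Local Open Scope classical_set_scope.
Local Open Scope ring_scope.

(* Finite-horizon POMDPs.  Steps h = 1..H of the paper are indexed by  *)
(* h : 'I_H (i.e. 0..H-1).                                             *)
Section POMDP.
Variables (R : realType) (S A O : finType) (H : nat).

Definition traj := {ffun 'I_H -> O * A}.

Definition policy := {dffun forall h : 'I_H, {ffun (h.-tuple (O * A) * O) -> A}}.

Definition hist (tau : traj) (h : 'I_H) : h.-tuple (O * A) :=
  [tuple tau (widen_ord (ltnW (ltn_ord h)) i) | i < h].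

Definition pol_prob (p : policy) (tau : traj) : R :=
  \prod_(h : 'I_H) ((p h (hist tau h, (tau h).1) == (tau h).2)%:R).

(* Pr^-(tau) = sum_{s_{1:H}} b1(s_1) prod_h Z_h(o_h|s_h) prod_{h<H} T_h(s_{h+1}|s_h,a_h) *)
Definition env_prob (b1 : S -> R) (Tr : 'I_H -> S -> A -> S -> R)
    (Zo : 'I_H -> S -> O -> R) (tau : traj) : R :=
  \sum_(s : {ffun 'I_H -> S})
    ((\prod_(h : 'I_H | val h == 0%N) b1 (s h)) *
     (\prod_(h : 'I_H) Zo h (s h) (tau h).1) *
     (\prod_(h : 'I_H)
        match (insub (val h).+1 : option 'I_H) with
        | Some h' => Tr h (s h) (tau h).2 (s h')
        | None => 1
        end)).

Definition traj_prob b1 Tr Zo (p : policy) (tau : traj) : R :=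
  pol_prob p tau * env_prob b1 Tr Zo tau.

Definition value (r : 'I_H -> O -> A -> R) b1 Tr Zo (p : policy) : R :=
  \sum_(tau : traj) traj_prob b1 Tr Zo p tau * \sum_(h : 'I_H) r h (tau h).1 (tau h).2.

(* V^* = max_pi V^pi  (values are nonnegative, so 0 is a harmless seed) *)
Definition opt_value r b1 Tr Zo : R :=
  \big[Num.max/0]_(p : policy) value r b1 Tr Zo p.

Definition obs_matrix (Zo : 'I_H -> S -> O -> R) (h : 'I_H) : 'M[R]_(#|O|, #|S|) :=
  \matrix_(i, j) Zo h (enum_val j) (enum_val i).

End POMDP.

(* smallest singular value of an m x n matrix with m >= n: the square root of
   the smallest eigenvalue of M^T M *)
Definition sigma_min (R : realType) (m n : nat) (M : 'M[R]_(m, n)) : R :=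
  Num.sqrt (inf [set a : R | eigenvalue (M^T *m M) a]).

Section PS.
Variables (R : realType) (S A O : finType) (H : nat) (r : 'I_H -> O -> A -> R).
Variables (d : measure_display) (T : measurableType d).
Variables (b1 : T -> S -> R) (Tr : T -> 'I_H -> S -> A -> S -> R)
          (Zo : T -> 'I_H -> S -> O -> R).
Variable (P : probability T R).          (* prior nu^1 *)
Variable (plan : T -> policy A O H).   (* exact planner: theta |-> argmax policy *)

Definition likelihood (D : seq (traj A O H * policy A O H)) (th : T) : R :=
  \prod_(x <- D) traj_prob (b1 th) (Tr th) (Zo th) x.2 x.1.

(* posterior probability (under nu^k, obtained from the prior by Bayes' rule
   on the data D) that the sampled parameter theta~ yields the policy p *)
Definition post_pol_prob (D : seq (traj A O H * policy A O H))
    (p : policy A O H) : R :=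
  Rintegral P setT (fun th => likelihood D th * (plan th == p)%:R)
  / Rintegral P setT (likelihood D).

(* BReg(phi^PS4POMDPs, K): expectation over theta^* ~ nu^1, over the policies
   pi^k = plan(theta~^k), theta~^k ~ nu^k, and the trajectories
   tau^k ~ Pr^{pi^k}_{theta^*}, of sum_k (V^*_{theta^*} - V^{pi^k}_{theta^*}). *)
Definition ps_breg (K : nat) : R :=
  Rintegral P setT (fun th =>
    \sum_(dat : {ffun 'I_K -> traj A O H * policy A O H})
      ((\prod_(k : 'I_K)
          (post_pol_prob (take k (codom dat)) (dat k).2 *
           traj_prob (b1 th) (Tr th) (Zo th) (dat k).2 (dat k).1)) *
       \sum_(k : 'I_K)
          (opt_value r (b1 th) (Tr th) (Zo th)
           - value r (b1 th) (Tr th) (Zo th) (dat k).2))).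

End PS.

(* Main.v *)
(* The regret of posterior sampling is compared with the information that the
   data carry on the parameter.

   Given the data, the true parameter and the sampled one are independent with
   the same law, the posterior. So the expected regret of an episode is the
   posterior average of V_t^{pi(t)} - V_{t*}^{pi(t)} over independent t, t*,
   while the information gained in that episode dominates the average squared
   Hellinger distance of P_t^{pi(t')} and P_{t*}^{pi(t')}, where the policy comes
   from a third independent parameter t'. To pass from the first average to the
   second, the difference of the trajectory laws is telescoped with observable
   operators; alpha-revealing observations bound these operators in l1 norm by
   kappa = sqrt S / alpha, and the argument loses kappa twice. Each term is a linear functional, depending on t, of the
   belief state under t*, a vector of dimension S whose law depends on the policy
   only. Leverage scores then replace pi(t) by pi(t') at a cost S for each of the
   O^2 A functionals of a step, and AM-GM with a free weight lambda keeps all the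
   inequalities linear, hence compatible with the averages.

   The total information is at most the logarithm of the mass of an upper
   bracket: the likelihoods are dominated by those of the models obtained by
   rounding all probabilities up to a grid, which are finitely many and have
   almost the mass of a probability. *)
Require Import Defs.
From HB Require Import structures.
From mathcomp Require Import all_boot all_order all_algebra.
From mathcomp Require Import all_classical all_reals all_analysis.
From mathcomp Require Import measurable_realfun ring lra.
Import Order.TTheory GRing.Theory Num.Theory.
Import numFieldNormedType.Exports.
Local Open Scope classical_set_scope.
Local Open Scope ring_scope.
Set Implicit Arguments.
Unset Strict Implicit.
Unset Printing Implicit Defensive.

(** The leverage step leaves squared errors divided by the likelihood under the true parameter, a
    chi-square quantity that total variation does not control. The Hellinger distance does: once the
    two laws are rescaled to equal mass on a history, the squared error is at most that likelihood
    times [kappa^2] times local Hellinger terms.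

    Every quantity attached to data is multiplied by the evidence of the data, so that data of
    evidence zero need only the convention that the inverse of 0 is 0.

    One lambda serves all data, episodes and parameters, and is fixed at the very end. With h, s, a,
    o, k the sizes of the problem and L a logarithm, the bound is X / lambda + Y lambda, where X is
    of order k h^2 kappa s a o^2 and Y of order h^2 kappa^3 times an information h s (s a + o) L.
    The balanced value is of order kappa^2 h^(5/2) s a^(1/2) o (s a + o)^(1/2) (L k)^(1/2), and
    kappa^2 = s / alpha^2 supplies the second power of s. *)

(** * Smallest singular value as a lower bound on norms *)

Section LinearAlgebra.
Variable R : realType.

Definition sqn n (v : 'rV[R]_n) : R := \sum_i v ord0 i ^+ 2.

Lemma sqnE n (v : 'rV[R]_n) : sqn v = (v *m v^T) ord0 ord0.
Proof. by rewrite mxE; apply: eq_bigr => i _; rewrite mxE expr2. Qed.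

Lemma sqn_ge0 n (v : 'rV[R]_n) : 0 <= sqn v.
Proof. by apply: sumr_ge0 => i _; exact: sqr_ge0. Qed.

Lemma sqn_eq0 n (v : 'rV[R]_n) : (sqn v == 0) = (v == 0).
Proof.
apply/idP/eqP => [|->]; last first.
  by rewrite /sqn big1 // => i _; rewrite mxE expr0n.
rewrite psumr_eq0 => [/allP h|i _]; last exact: sqr_ge0.
apply/rowP => i; rewrite mxE; apply/eqP.
by have := h i (mem_index_enum i); rewrite /= sqrf_eq0.
Qed.

Lemma sqnZ n a (v : 'rV[R]_n) : sqn (a *: v) = a ^+ 2 * sqn v.
Proof.
by rewrite /sqn mulr_sumr; apply: eq_bigr => i _; rewrite mxE exprMn.
Qed.

Lemma continuous_bigsum (V : topologicalType) (I : Type) (s : seq I)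
    (F : I -> V -> R) :
  (forall i, continuous (F i)) -> continuous (fun v => \sum_(i <- s) F i v).
Proof.
move=> cF; elim: s => [|i s IH] v.
  have -> : (fun v => \sum_(i <- [::]) F i v) = (fun=> 0 : R).
    by apply/funext => w; rewrite big_nil.
  exact: cvg_cst.
have -> : (fun v => \sum_(j <- i :: s) F j v) =
          (fun v => F i v + \sum_(j <- s) F j v).
  by apply/funext => w; rewrite big_cons.
by apply: cvgD; [exact: cF|exact: IH].
Qed.

Lemma continuous_quad n (N : 'M[R]_n) :
  continuous (fun v : 'rV[R]_n => (v *m N *m v^T) ord0 ord0).
Proof.
have -> : (fun v : 'rV[R]_n => (v *m N *m v^T) ord0 ord0) =
   (fun v => \sum_j \sum_i v ord0 i * N i j * v ord0 j).
  apply/funext => v; rewrite mxE; apply: eq_bigr => j _.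
  by rewrite !mxE mulr_suml.
apply: continuous_bigsum => j; apply: continuous_bigsum => i v.
have cc k : {for v, continuous (fun v : 'rV[R]_n => v ord0 k)}.
  exact: coord_continuous.
apply: (continuousM _ (cc j)); apply: (continuousM (cc i)).
exact: cst_continuous.
Qed.

Lemma sphere_compact n : compact [set v : 'rV[R]_n.+1 | sqn v = 1].
Proof.
apply: bounded_closed_compact.
  exists 1; split => // M M1 v /= v1.
  have -> : `|v| = mx_norm v by [].
  rewrite mx_normrE; apply/bigmax_leP; split.
    by rewrite (le_trans ler01) // ltW.
  move=> [i j] _ /=; rewrite (ord1 i); apply: le_trans (ltW M1).
  rewrite -(@ler_pXn2r _ 2) ?nnegrE // expr1n -v1 real_normK ?num_real //.
  rewrite /sqn (bigD1 j) //= lerDl; apply: sumr_ge0 => k _; exact: sqr_ge0.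
have -> : [set v : 'rV[R]_n.+1 | sqn v = 1] = (@sqn n.+1) @^-1` [set 1].
  by [].
have cs : continuous (@sqn n.+1).
  apply: continuous_bigsum => i v.
  have cc : {for v, continuous (fun v : 'rV[R]_n.+1 => v ord0 i)}.
    exact: coord_continuous.
  exact: (continuousM cc cc).
by move/continuous_closedP : cs; apply; exact: closed_eq.
Qed.

(* The minimum of the Rayleigh quotient is attained, and its value is an
   eigenvalue. *)
Lemma sym_min_eigenvalue n (N : 'M[R]_n.+1) : N^T = N ->
  exists2 mu, eigenvalue N mu &
    forall v : 'rV_n.+1, mu * sqn v <= (v *m N *m v^T) ord0 ord0.
Proof.
move=> symN.
pose f (v : 'rV[R]_n.+1) := (v *m N *m v^T) ord0 ord0.
have [] := @EVT_min_rV R n.+1 f [set v | sqn v = 1].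
- exists (delta_mx ord0 ord0) => /=.
  rewrite /sqn (bigD1 ord0) //= !mxE !eqxx expr1n big1 ?addr0 // => i i0.
  by rewrite mxE (negbTE i0) andbF expr0n.
- exact: sphere_compact.
- by apply: continuous_subspaceT; exact: continuous_quad.
move=> v0; rewrite inE /= => v01 v0min; pose mu := f v0.
have fZ a v : f (a *: v) = a ^+ 2 * f v.
  rewrite /f linearZ /= -scalemxAr -!scalemxAl !mxE expr2 -!mulrA.
  by congr (_ * _); congr (_ * _); rewrite mxE.
have ray v : mu * sqn v <= f v.
  have [->|v_neq0] := eqVneq v 0.
    by rewrite /f !mul0mx mxE /sqn big1 ?mulr0 // => i _; rewrite mxE expr0n.
  have sv : 0 < sqn v by rewrite lt_neqAle eq_sym sqn_eq0 v_neq0 sqn_ge0.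
  have := v0min ((Num.sqrt (sqn v))^-1 *: v).
  rewrite inE /= sqnZ exprVn sqr_sqrtr ?sqn_ge0 // mulVf ?gt_eqF //.
  by move=> /(_ erefl); rewrite fZ exprVn sqr_sqrtr ?sqn_ge0 // ler_pdivlMl // mulrC.
exists mu => //.
pose G := N - mu%:M.
have symG : G^T = G by rewrite /G linearB /= symN tr_scalar_mx.
pose g (v : 'rV[R]_n.+1) := (v *m G *m v^T) ord0 ord0.
have gE v : g v = f v - mu * sqn v.
  rewrite /g /G mulmxBr mulmxBl mul_mx_scalar -scalemxAl [LHS]mxE; congr (_ + _).
  by rewrite mxE [X in - X]mxE sqnE.
have g_ge0 v : 0 <= g v by rewrite gE subr_ge0.
have g0 : g v0 = 0 by rewrite gE v01 mulr1 subrr.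
(* [g] is nonnegative and vanishes at [v0], so its first variation there vanishes; in the direction
   [w = v0 G] this variation is [2 |w|^2], which makes [v0] an eigenvector. *)
pose w := v0 *m G; pose b := sqn w; pose c := g w.
have exp t : g (v0 + t *: w) = 2 * t * b + t ^+ 2 * c.
  rewrite /g mulmxDl.
  have -> : (v0 + t *: w)^T = v0^T + t *: w^T by apply/matrixP => i j; rewrite !mxE.
  rewrite mulmxDr !mulmxDl -!scalemxAl -!scalemxAr.
  have e1 : v0 *m G *m w^T = w *m w^T by [].
  have e2 : w *m G *m v0^T = w *m w^T.
    by rewrite /w trmx_mul symG -!mulmxA.
  have entD (A B : 'M[R]_1) : (A + B) ord0 ord0 = A ord0 ord0 + B ord0 ord0.
    by rewrite mxE.
  have entZ a (A : 'M[R]_1) : (a *: A) ord0 ord0 = a * A ord0 ord0.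
    by rewrite mxE.
  rewrite e1 e2 !entD !entZ -/(g v0) -/(g w) g0 -sqnE -/b -/c.
  by ring.
have c0 : 0 <= c by exact: g_ge0.
have b0 : b = 0.
  (* The minimiser of the quadratic would be [t = - b / c]; dividing by [c + 1] covers [c = 0] and
     still gives a negative value unless [b = 0]. *)
  have := g_ge0 (v0 + (- b / (c + 1)) *: w); rewrite exp.
  have c1 : c + 1 != 0 by rewrite gt_eqF // ltr_wpDl.
  have -> : 2 * (- b / (c + 1)) * b + (- b / (c + 1)) ^+ 2 * c =
            - (b ^+ 2 * ((c + 2) / (c + 1) ^+ 2)).
    by field.
  rewrite oppr_ge0 pmulr_lle0; last first.
    by rewrite divr_gt0 ?exprn_gt0 // ltr_wpDl.
  by move=> b2; apply/eqP; rewrite -sqrf_eq0 eq_le b2 sqr_ge0.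
apply/eigenvalueP; exists v0; last first.
  apply/eqP => v00; have /eqP := v01.
  have /eqP -> : sqn v0 == 0 by rewrite sqn_eq0 v00.
  by rewrite eq_sym oner_eq0.
move/eqP: b0; rewrite sqn_eq0 /w /G mulmxBr mul_mx_scalar subr_eq0.
by move/eqP.
Qed.

(** The infimum in [sigma_min] runs over the eigenvalues of [M^T M], all nonnegative, and the
    minimum of the Rayleigh quotient is one of them. *)
Lemma sigma_min_sqn m n (M : 'M[R]_(m, n.+1)) alpha : 0 < alpha ->
  alpha <= sigma_min M ->
  forall v : 'rV_n.+1, alpha ^+ 2 * sqn v <= sqn (v *m M^T).
Proof.
move=> a0 aM v; set N := M^T *m M.
have NE (u : 'rV[R]_n.+1) : (u *m N *m u^T) ord0 ord0 = sqn (u *m M^T).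
  by rewrite sqnE trmx_mul trmxK /N !mulmxA.
have symN : N^T = N by rewrite /N trmx_mul trmxK.
have [mu emu hmu] := sym_min_eigenvalue symN.
rewrite -NE; apply: le_trans (hmu v); rewrite ler_wpM2r ?sqn_ge0 //.
have lb : lbound [set a : R | eigenvalue N a] 0.
  move=> a /= /eigenvalueP [u uN u0].
  have := sqn_ge0 (u *m M^T); rewrite -NE uN -scalemxAl mxE -sqnE.
  by rewrite pmulr_lge0 // lt_neqAle eq_sym sqn_eq0 u0 sqn_ge0.
have infmu : inf [set a : R | eigenvalue N a] <= mu.
  by apply: ge_inf => //; exists 0.
apply: le_trans infmu.
have inf0 : 0 <= inf [set a : R | eigenvalue N a].
  by apply: lb_le_inf => //; exists mu.
rewrite -(sqr_sqrtr inf0) ler_pXn2r ?nnegrE ?sqrtr_ge0 //; exact: ltW.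
Qed.

End LinearAlgebra.

Lemma cauchy_schwarz_sum (R : realFieldType) (I : finType) (a b : I -> R) :
  (\sum_i a i * b i) ^+ 2 <= (\sum_i a i ^+ 2) * \sum_i b i ^+ 2.
Proof.
have : 0 <= \sum_i \sum_j (a i * b j - a j * b i) ^+ 2.
  by apply: sumr_ge0 => i _; apply: sumr_ge0 => j _; exact: sqr_ge0.
have -> : \sum_i \sum_j (a i * b j - a j * b i) ^+ 2 =
    2 * ((\sum_i a i ^+ 2) * (\sum_i b i ^+ 2)) - 2 * (\sum_i a i * b i) ^+ 2.
  have -> : (\sum_i a i * b i) ^+ 2 = \sum_i \sum_j a i * b i * (a j * b j).
    by rewrite expr2 mulr_suml; apply: eq_bigr => i _; rewrite mulr_sumr.
  have -> : 2 * ((\sum_i a i ^+ 2) * (\sum_i b i ^+ 2)) =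
      \sum_i \sum_j a i ^+ 2 * b j ^+ 2 + \sum_i \sum_j a j ^+ 2 * b i ^+ 2.
    have pE : (\sum_i a i ^+ 2) * (\sum_i b i ^+ 2) =
        \sum_i \sum_j a i ^+ 2 * b j ^+ 2.
      by rewrite mulr_suml; apply: eq_bigr => i _; rewrite mulr_sumr.
    by rewrite [X in _ = _ + X]exchange_big /= -pE; ring.
  rewrite mulr_sumr -big_split -sumrB /=; apply: eq_bigr => i _.
  rewrite mulr_sumr -big_split -sumrB /=; apply: eq_bigr => j _.
  by ring.
by rewrite subr_ge0 ler_pM2l.
Qed.

(** * Left inverses and leverage scores *)

Section LeftInverse.
Variable R : realType.

Lemma unitmx_inj n (A : 'M[R]_n) :
  (forall u : 'rV_n, u *m A = 0 -> u = 0) -> A \in unitmx.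
Proof.
move=> injA; rewrite -row_free_unit -kermx_eq0; apply/rowV0P => v.
by move/sub_kermxP/injA.
Qed.

(** The Moore-Penrose inverse. The image under [M] of [W v] is the orthogonal projection [z] of [v]
    on the range of [M], so that [alpha |W v| <= |z| <= |v|]; the last inequality is Pythagoras. *)
Lemma left_inverse_sqn m n (M : 'M[R]_(m, n.+1)) alpha : 0 < alpha ->
  alpha <= sigma_min M ->
  exists2 W : 'M[R]_(n.+1, m), W *m M = 1%:M &
    forall v : 'rV_m, alpha ^+ 2 * sqn (v *m W^T) <= sqn v.
Proof.
move=> a0 aM; have hM := sigma_min_sqn a0 aM.
have uN : M^T *m M \in unitmx.
  apply: unitmx_inj => u uN0; apply/eqP; rewrite -sqn_eq0.
  have := hM u; rewrite [X in _ <= X]sqnE trmx_mul trmxK -mulmxA.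
  rewrite [M^T *m _]mulmxA mulmxA uN0 mul0mx mxE.
  by rewrite pmulr_rle0 ?exprn_gt0 // eq_le sqn_ge0 andbT.
exists (invmx (M^T *m M) *m M^T); first by rewrite -mulmxA mulVmx.
move=> v; set u := v *m _; apply: le_trans (hM u) _.
have uE : u *m M^T *m M = v *m M.
  rewrite /u !trmx_mul trmxK trmx_inv trmx_mul trmxK -!mulmxA.
  by rewrite mulVmx // mulmx1.
set z := u *m M^T.
have dotE : (v *m z^T) ord0 ord0 = sqn z.
  rewrite sqnE {1 2}/z trmx_mul trmxK mulmxA -uE -/z.
  by rewrite /z trmx_mul trmxK !mulmxA.
have : 0 <= sqn (v - z) by exact: sqn_ge0.
have -> : sqn (v - z) = sqn v - sqn z; last by rewrite subr_ge0.
rewrite /sqn.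
have -> : \sum_i (v - z) ord0 i ^+ 2 =
   \sum_i v ord0 i ^+ 2 + sqn z - 2 * (v *m z^T) ord0 ord0.
  rewrite mxE mulr_sumr /sqn -big_split -sumrB /=; apply: eq_bigr => i _.
  by rewrite !mxE; ring.
by rewrite dotE /sqn; ring.
Qed.

Lemma l1_le_sqn n (u : 'rV[R]_n) :
  \sum_i `|u ord0 i| <= Num.sqrt n%:R * Num.sqrt (sqn u).
Proof.
rewrite -sqrtrM ?ler0n // -(@ger0_norm _ (\sum_i _)); last exact: sumr_ge0.
rewrite -sqrtr_sqr ler_sqrt; last by rewrite mulr_ge0 ?sqn_ge0.
have := cauchy_schwarz_sum (fun _ : 'I_n => 1) (fun i => `|u ord0 i|).
under eq_bigr do rewrite mul1r.
rewrite expr1n sumr_const card_ord => /le_trans; apply.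
rewrite ler_wpM2l ?ler0n // le_eqVlt; apply/orP; left; apply/eqP.
by apply: eq_bigr => i _; rewrite real_normK ?num_real.
Qed.

Lemma sqn_le_l1 n (u : 'rV[R]_n) : Num.sqrt (sqn u) <= \sum_i `|u ord0 i|.
Proof.
rewrite -[leRHS]ger0_norm; last exact: sumr_ge0.
rewrite -sqrtr_sqr ler_sqrt ?sqr_ge0 // /sqn expr2 mulr_suml.
apply: ler_sum => i _; rewrite -[u _ _ ^+ 2]real_normK ?num_real // expr2.
rewrite ler_wpM2l // (bigD1 i) //= lerDl; exact: sumr_ge0.
Qed.

(** The factor [sqrt #|S|] is the price of passing from the Euclidean norm to l1 on the [S] side; on
    the [O] side the Euclidean norm is below l1 for free. *)
Lemma left_inverse_l1 (S O : finType) (Z : S -> O -> R) alpha : 0 < alpha ->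
  (0 < #|S|)%N ->
  alpha <= sigma_min (\matrix_(i < #|O|, j < #|S|) Z (enum_val j) (enum_val i)) ->
  exists2 W : S -> O -> R,
    forall s s', \sum_o W s o * Z s' o = (s == s')%:R &
    forall v : O -> R, \sum_s `|\sum_o W s o * v o| <=
       Num.sqrt #|S|%:R / alpha * \sum_o `|v o|.
Proof.
move=> a0 S0; set M := (X in sigma_min X) => aM.
have [W WM hW] : exists2 W : 'M[R]_(#|S|, #|O|), W *m M = 1%:M &
    forall v : 'rV_#|O|, alpha ^+ 2 * sqn (v *m W^T) <= sqn v.
  move: M aM; case: #|S| S0 => // n _ M; exact: left_inverse_sqn.
exists (fun s o => W (enum_rank s) (enum_rank o)) => [s s'|v].
  have := congr1 (fun A : 'M[R]__ => A (enum_rank s) (enum_rank s')) WM.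
  rewrite mxE [RHS]mxE (inj_eq enum_rank_inj) => <-.
  rewrite (reindex_onto (fun i : 'I_#|O| => enum_val i) (fun o : O => enum_rank o)) /=; last first.
    by move=> o _; rewrite enum_rankK.
  apply: eq_big => [i|i _]; first by rewrite enum_valK eqxx.
  by rewrite !mxE enum_rankK !enum_valK.
pose vr : 'rV[R]_#|O| := \row_i v (enum_val i).
have sumO (F : O -> R) : \sum_o F o = \sum_(i < #|O|) F (enum_val i).
  rewrite (reindex_onto (fun i : 'I_#|O| => enum_val i) (fun o : O => enum_rank o)) /=; last first.
    by move=> o _; rewrite enum_rankK.
  by apply: eq_bigl => i; rewrite enum_valK eqxx.
have -> : \sum_s `|\sum_o W (enum_rank s) (enum_rank o) * v o| =
          \sum_i `|(vr *m W^T) ord0 i|.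
  rewrite (reindex_onto (fun i : 'I_#|S| => enum_val i) (fun o : S => enum_rank o)) /=; last first.
    by move=> o _; rewrite enum_rankK.
  apply: eq_big => [i|i _]; first by rewrite enum_valK eqxx.
  congr `|_|; rewrite sumO mxE; apply: eq_bigr => o _.
  by rewrite !mxE !enum_valK mulrC.
have -> : \sum_o `|v o| = \sum_i `|vr ord0 i|.
  by rewrite sumO; apply: eq_bigr => i _; rewrite mxE.
apply: le_trans (l1_le_sqn _) _; rewrite -mulrA ler_wpM2l ?sqrtr_ge0 //.
apply: le_trans _ (ler_wpM2l _ (sqn_le_l1 vr)); last by rewrite invr_ge0 ltW.
rewrite ler_pdivlMl // -[X in X * _](ger0_norm (ltW a0)) -sqrtr_sqr.
by rewrite -sqrtrM ?sqr_ge0 // ler_sqrt ?sqn_ge0.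
Qed.

(* The [l i] are the leverage scores of the weighted family [x]: diagonal
   entries of the orthogonal projection onto the row space of [sqrt Q x],
   whose trace is at most the dimension. *)
Lemma leverage_scores (I S : finType) (x : I -> S -> R) (Q : I -> R) :
  (forall i, 0 <= Q i) ->
  exists l : I -> R, [/\ forall i, 0 <= l i,
    forall (w : S -> R) i, 0 < Q i ->
      (\sum_s w s * x i s) ^+ 2 <=
        l i * \sum_j Q j * (\sum_s w s * x j s) ^+ 2 &
    \sum_i Q i * l i <= #|S|%:R].
Proof.
move=> Q0.
pose Y : 'M[R]_(#|S|, #|I|) :=
  \matrix_(s, i) (Num.sqrt (Q (enum_val i)) * x (enum_val i) (enum_val s)).
(* [Y] may be rank deficient, so the projection on its row space is built from a basis of that
   space, whose Gram matrix is invertible. *)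
have [B freeB [C YE]] : exists2 B : 'M[R]_(\rank Y, #|I|), row_free B &
    exists C, Y = C *m B.
  by exists (row_base Y); [exact: row_base_free|apply/submxP; rewrite eq_row_base].
have uB : B *m B^T \in unitmx.
  apply: unitmx_inj => u uB0; apply: (row_free_inj freeB).
  rewrite mul0mx; apply/eqP; rewrite -sqn_eq0 sqnE trmx_mul mulmxA.
  by rewrite -[u *m B *m _]mulmxA uB0 mul0mx mxE.
pose Pi := B^T *m invmx (B *m B^T) *m B.
have YPi : Y *m Pi = Y.
  have : C *m B *m Pi = C *m B.
    by rewrite /Pi !mulmxA -[C *m B *m B^T]mulmxA mulmxK.
  by rewrite -YE.
have symPi : Pi^T = Pi.
  by rewrite /Pi !trmx_mul trmxK trmx_inv trmx_mul trmxK mulmxA.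
have idPi : Pi *m Pi = Pi.
  rewrite /Pi !mulmxA -[B^T *m _ *m B *m B^T]mulmxA.
  by rewrite mulmxKV.
have Pi_diag i : Pi i i = \sum_j Pi j i ^+ 2.
  rewrite -{1}idPi mxE; apply: eq_bigr => j _.
  by rewrite -{1}symPi mxE expr2.
have trPi : \sum_i Pi i i <= #|S|%:R.
  have -> : \sum_i Pi i i = \tr Pi by [].
  by rewrite /Pi mxtrace_mulC mulmxA mulmxV // mxtrace1 ler_nat rank_leq_row.
have Pi0 i : 0 <= Pi i i.
  by rewrite Pi_diag; apply: sumr_ge0 => j _; exact: sqr_ge0.
have sumI (F : I -> R) : \sum_o F o = \sum_(i < #|I|) F (enum_val i).
  rewrite (reindex_onto (fun i : 'I_#|I| => enum_val i) (fun o : I => enum_rank o)) /=; last first.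
    by move=> o _; rewrite enum_rankK.
  by apply: eq_bigl => i; rewrite enum_valK eqxx.
have sumS (F : S -> R) : \sum_o F o = \sum_(i < #|S|) F (enum_val i).
  rewrite (reindex_onto (fun i : 'I_#|S| => enum_val i) (fun o : S => enum_rank o)) /=; last first.
    by move=> o _; rewrite enum_rankK.
  by apply: eq_bigl => i; rewrite enum_valK eqxx.
exists (fun i => Pi (enum_rank i) (enum_rank i) / Q i); split.
- by move=> i; rewrite divr_ge0.
- move=> w i Qi; pose z := (\row_s w (enum_val s)) *m Y.
  have zE j : z ord0 (enum_rank j) = Num.sqrt (Q j) * \sum_s w s * x j s.
    rewrite /z mxE sumS mulr_sumr; apply: eq_bigr => s _.
    by rewrite !mxE enum_rankK mulrCA.
  have zPi : z *m Pi = z by rewrite /z -mulmxA YPi.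
  (* [z] lies in the row space, so its entry at [i] is the inner product of [z] with column [i] of
     [Pi], whose squared norm is the diagonal entry. *)
  have : z ord0 (enum_rank i) ^+ 2 <=
     (\sum_j z ord0 j ^+ 2) * Pi (enum_rank i) (enum_rank i).
    by rewrite -{1}zPi mxE Pi_diag; exact: cauchy_schwarz_sum.
  have -> : \sum_j z ord0 j ^+ 2 = \sum_j Q j * (\sum_s w s * x j s) ^+ 2.
    rewrite sumI; apply: eq_bigr => j _.
    by rewrite -{1}(enum_valK j) zE exprMn sqr_sqrtr.
  rewrite zE exprMn sqr_sqrtr // => h.
  by rewrite mulrAC ler_pdivlMr // mulrC [X in _ <= X]mulrC.
- apply: le_trans trPi; rewrite sumI; apply: ler_sum => i _; rewrite enum_valK.
  have [->|Qi] := eqVneq (Q (enum_val i)) 0; first by rewrite mul0r.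
  by rewrite mulrCA mulfV // mulr1.
Qed.

End LeftInverse.

(** * Unnormalised beliefs, observable operators and their telescoping *)

Lemma big_tuple_cons (V : nmodType) (X : finType) n (F : seq X -> V) :
  \sum_(t : n.+1.-tuple X) F t = \sum_x \sum_(t : n.-tuple X) F (x :: t).
Proof.
rewrite pair_big /=.
rewrite (reindex (fun p : X * n.-tuple X => [tuple of p.1 :: p.2])) //=.
exists (fun t => (thead t, [tuple of behead t])) => [[x t] _|t _] /=.
  by congr (_, _); apply: val_inj.
by rewrite -tuple_eta.
Qed.

Lemma big_tuple_nil (V : nmodType) (X : finType) (F : seq X -> V) :
  \sum_(t : 0.-tuple X) F t = F [::].
Proof.
rewrite (eq_bigr (fun=> F [::])) => [|t _]; last by rewrite (tuple0 t).
by rewrite sumr_const card_tuple.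
Qed.

Section Model.
Variables (R : realType) (S A O : finType).

(* Histories are stored newest first and kernels are indexed by [nat]: the step
   of a history is its size. *)
Record model := Model {
  minit : S -> R;
  mtrans : nat -> S -> A -> S -> R;
  mobs : nat -> S -> O -> R }.

Definition stochastic m :=
  [/\ forall s, 0 <= minit m s, \sum_s minit m s = 1,
      forall n s a s', 0 <= mtrans m n s a s' /\
        \sum_s2 mtrans m n s a s2 = 1 &
      forall n s o, 0 <= mobs m n s o /\ \sum_o' mobs m n s o' = 1].

Implicit Types (m ms : model) (l : seq (O * A)) (g : seq (O * A) -> O -> A).

(** The unnormalised belief: the joint probability, given the actions of [l], of the observations of
    [l] and of the state reached after them, before it emits. *)
Fixpoint bel m l : S -> R :=
  if l is x :: l' then
    fun s' => \sum_s mtrans m (size l') s x.2 s' * mobs m (size l') s x.1 * bel m l' s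
  else minit m.

Definition obs m l o := \sum_s mobs m (size l) s o * bel m l s.

Definition lik m l := \sum_s bel m l s.

Fixpoint polw g l : R :=
  if l is x :: l' then (g l' x.1 == x.2)%:R * polw g l' else 1.

(** Policies are deterministic, so this is a sum over the histories compatible with [g]; the
    probability of the observations has to come from [F]. *)
Definition psum g n (F : seq (O * A) -> R) :=
  \sum_(l : n.-tuple (O * A)) polw g l * F l.

Lemma polw_ge0 g l : 0 <= polw g l.
Proof. by elim: l => //= x l IH; rewrite mulr_ge0 // ler0n. Qed.

Lemma psum0 g F : psum g 0 F = F [::].
Proof.
by rewrite /psum (big_tuple_nil (fun l => polw g l * F l)) /= mul1r.
Qed.

Lemma psumS g (n : nat) F :
  psum g n.+1 F = psum g n (fun l => \sum_o F ((o, g l o) :: l)).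
Proof.
rewrite /psum (big_tuple_cons _ (fun l => polw g l * F l)) exchange_big /=.
apply: eq_bigr => l _.
rewrite mulr_sumr.
transitivity (\sum_o \sum_a (g l o == a)%:R * polw g l * F ((o, a) :: l)).
  by rewrite pair_big; apply: eq_bigr => -[].
apply: eq_bigr => o _; rewrite (bigD1 (g l o)) //= eqxx mul1r big1 ?addr0 // => a ag.
by rewrite eq_sym (negbTE ag) mul0r mul0r.
Qed.

Lemma eq_psum g n F G : (forall l, size l = n -> F l = G l) ->
  psum g n F = psum g n G.
Proof. by move=> FG; apply: eq_bigr => l _; rewrite FG // size_tuple. Qed.

Lemma ler_psum g n F G : (forall l, size l = n -> F l <= G l) ->
  psum g n F <= psum g n G.
Proof.
move=> FG; apply: ler_sum => l _; apply: ler_wpM2l; first exact: polw_ge0.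
by rewrite FG // size_tuple.
Qed.

Lemma psum_ge0 g n F : (forall l, size l = n -> 0 <= F l) -> 0 <= psum g n F.
Proof.
move=> F0; apply: sumr_ge0 => l _.
by rewrite mulr_ge0 ?polw_ge0 ?F0 ?size_tuple.
Qed.

Lemma psumD g n F G : psum g n (fun l => F l + G l) = psum g n F + psum g n G.
Proof. by rewrite /psum -big_split; apply: eq_bigr => l _; rewrite /= mulrDr. Qed.

Lemma psumZ g n c F : psum g n (fun l => c * F l) = c * psum g n F.
Proof. by rewrite /psum mulr_sumr; apply: eq_bigr => l _; rewrite mulrCA. Qed.

Section Stochastic.
Variables (m : model) (stm : stochastic m).

Let T_ge0 n s a s' : 0 <= mtrans m n s a s'.
Proof. by have [_ _ h _] := stm; have [] := h n s a s'. Qed.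
Let T_sum n s a : \sum_s2 mtrans m n s a s2 = 1.
Proof. by have [_ _ h _] := stm; have [] := h n s a s. Qed.
Let Z_ge0 n s o : 0 <= mobs m n s o.
Proof. by have [_ _ _ h] := stm; have [] := h n s o. Qed.
Let Z_sum n s : (exists o : O, True) -> \sum_o' mobs m n s o' = 1.
Proof. by case=> o _; have [_ _ _ h] := stm; have [] := h n s o. Qed.

Lemma bel_ge0 l s : 0 <= bel m l s.
Proof.
elim: l s => [|x l IH] s /=; first by have [h _ _ _] := stm.
by apply: sumr_ge0 => s' _; rewrite !mulr_ge0.
Qed.

Lemma obs_ge0 l o : 0 <= obs m l o.
Proof. by apply: sumr_ge0 => s _; rewrite mulr_ge0 // bel_ge0. Qed.

Lemma lik_ge0 l : 0 <= lik m l.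
Proof. by apply: sumr_ge0 => s _; exact: bel_ge0. Qed.

(** The last action only governs the state that follows, and this state is summed out. *)
Lemma lik_cons x l : lik m (x :: l) = obs m l x.1.
Proof.
rewrite /lik /= exchange_big /=; apply: eq_bigr => s _.
by rewrite -mulr_suml -mulr_suml T_sum mul1r.
Qed.

Lemma lik_nil : lik m [::] = 1.
Proof. by have [_ h _ _] := stm. Qed.

Hypothesis exO : exists o : O, True.

Lemma sum_obs l : \sum_o obs m l o = lik m l.
Proof.
rewrite /obs exchange_big /=; apply: eq_bigr => s _.
by rewrite -mulr_suml Z_sum // mul1r.
Qed.

Lemma psum_lik g n : psum g n (lik m) = 1.
Proof.
elim: n => [|n IH]; first by rewrite psum0 lik_nil.
rewrite psumS -[RHS]IH; apply: eq_psum => l _; rewrite -sum_obs.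
by apply: eq_bigr => o _; rewrite lik_cons.
Qed.

Lemma mobs_l1 n (u : S -> R) :
  \sum_o `|\sum_s mobs m n s o * u s| <= \sum_s `|u s|.
Proof.
apply: (@le_trans _ _ (\sum_o \sum_s mobs m n s o * `|u s|)).
  apply: ler_sum => o _; apply: le_trans (ler_norm_sum _ _ _) _.
  by apply: ler_sum => s _; rewrite normrM ger0_norm.
rewrite exchange_big /=; apply: ler_sum => s _.
by rewrite -mulr_suml Z_sum // mul1r.
Qed.

(** With the action a function of the observation, the emitted observation and the next state have a
    joint probability law given the state; this is why no factor [#|A|] appears. *)
Lemma step_l1 n (f : O -> A) (u : S -> R) :
  \sum_o \sum_s' `|\sum_s mtrans m n s (f o) s' * mobs m n s o * u s| <=
  \sum_s `|u s|.
Proof.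
apply: (@le_trans _ _ (\sum_o \sum_s' \sum_s
    mtrans m n s (f o) s' * mobs m n s o * `|u s|)).
  apply: ler_sum => o _; apply: ler_sum => s' _.
  apply: le_trans (ler_norm_sum _ _ _) _; apply: ler_sum => s _.
  by rewrite normrM ger0_norm // mulr_ge0.
under eq_bigr do rewrite exchange_big /=.
rewrite exchange_big /=; apply: ler_sum => s _.
have -> : \sum_o \sum_s' mtrans m n s (f o) s' * mobs m n s o * `|u s| =
          \sum_o mobs m n s o * `|u s|.
  apply: eq_bigr => o _.
  by rewrite -mulr_suml -mulr_suml T_sum mul1r.
by rewrite -mulr_suml Z_sum // mul1r.
Qed.

End Stochastic.

(* [W n] is a left inverse of the observation matrix of [m] at step [n]; the
   operator [oom n x], acting on vectors of observation probabilities, is the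
   observable operator of [m] for the observation-action pair [x]. *)
Definition left_inv m (W : nat -> S -> O -> R) :=
  forall n s s', \sum_o W n s o * mobs m n s' o = (s == s')%:R.

Definition l1_bound (W : nat -> S -> O -> R) kappa :=
  forall n (v : O -> R), \sum_s `|\sum_o W n s o * v o| <= kappa * \sum_o `|v o|.

Definition oom m (W : nat -> S -> O -> R) n (x : O * A) (v : O -> R) o' :=
  \sum_s2 mobs m n.+1 s2 o' *
    \sum_s mtrans m n s x.2 s2 * mobs m n s x.1 * \sum_o1 W n s o1 * v o1.

(** The error is kept in the form of weights applied to the belief under [ms]: they see the past
    only through its length, as the leverage scores require. *)
Definition errw m W ms n (x : O * A) o' s :=
  oom m W n x (mobs ms n s) o' -
  \sum_s2 mobs ms n.+1 s2 o' * (mtrans ms n s x.2 s2 * mobs ms n s x.1).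

Definition err m W ms l x o' := \sum_s errw m W ms (size l) x o' s * bel ms l s.

Section Oom.
Variables (m : model) (W : nat -> S -> O -> R) (kappa : R).
Hypotheses (stm : stochastic m) (Wm : left_inv m W) (Wk : l1_bound W kappa).
Hypothesis exO : exists o : O, True.

Lemma left_inv_obs l s : \sum_o W (size l) s o * obs m l o = bel m l s.
Proof.
under eq_bigr do rewrite mulr_sumr.
rewrite exchange_big /= (bigD1 s) //= [X in _ + X]big1 => [|s' s's].
  by under eq_bigr do rewrite mulrA; rewrite -mulr_suml Wm eqxx mul1r addr0.
under eq_bigr do rewrite mulrA.
by rewrite -mulr_suml Wm eq_sym (negbTE s's) mul0r.
Qed.

Lemma oom_obs l x o' : oom m W (size l) x (obs m l) o' = obs m (x :: l) o'.
Proof.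
apply: eq_bigr => s2 _; congr (_ * _); apply: eq_bigr => s _.
by rewrite left_inv_obs.
Qed.

Lemma oomB n x (u v : O -> R) o' :
  oom m W n x (fun o => u o - v o) o' = oom m W n x u o' - oom m W n x v o'.
Proof.
rewrite /oom -sumrB; apply: eq_bigr => s2 _; rewrite -mulrBr -sumrB.
congr (_ * _); apply: eq_bigr => s _; rewrite -mulrBr -sumrB.
by congr (_ * _); apply: eq_bigr => o _; rewrite mulrBr.
Qed.

Lemma oomZ n x c (u : O -> R) o' :
  oom m W n x (fun o => c * u o) o' = c * oom m W n x u o'.
Proof.
rewrite /oom mulr_sumr; apply: eq_bigr => s2 _; rewrite mulrCA.
congr (_ * _); rewrite mulr_sumr; apply: eq_bigr => s _; rewrite mulrCA.
by congr (_ * _); rewrite mulr_sumr; apply: eq_bigr => o _; rewrite mulrCA.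
Qed.

Lemma oom_sum n x (u : S -> O -> R) (b : S -> R) o' :
  oom m W n x (fun o => \sum_s u s o * b s) o' = \sum_s oom m W n x (u s) o' * b s.
Proof.
rewrite /oom; under [RHS]eq_bigr do rewrite mulr_suml.
rewrite [RHS]exchange_big /=; apply: eq_bigr => s2 _.
under [RHS]eq_bigr do rewrite -mulrA.
rewrite -mulr_sumr; congr (_ * _).
under [RHS]eq_bigr do rewrite mulr_suml.
rewrite [RHS]exchange_big /=; apply: eq_bigr => s _.
under [RHS]eq_bigr do rewrite -mulrA.
rewrite -mulr_sumr; congr (_ * _).
under [RHS]eq_bigr do rewrite mulr_suml.
rewrite [RHS]exchange_big /=; apply: eq_bigr => o _.
by rewrite mulr_sumr; apply: eq_bigr => s1 _; rewrite mulrA.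
Qed.

Lemma errE ms l x o' :
  err m W ms l x o' = oom m W (size l) x (obs ms l) o' - obs ms (x :: l) o'.
Proof.
rewrite /err /errw; under eq_bigr do rewrite mulrBl.
rewrite sumrB /obs oom_sum; congr (_ - _) => /=.
under eq_bigr do rewrite mulr_suml.
rewrite exchange_big /=; apply: eq_bigr => s2 _.
rewrite mulr_sumr; apply: eq_bigr => s _.
by rewrite -!mulrA.
Qed.

Lemma oom_l1 n (f : O -> A) (v : O -> R) :
  \sum_o \sum_o' `|oom m W n (o, f o) v o'| <= kappa * \sum_o `|v o|.
Proof.
apply: le_trans _ (Wk n v).
apply: le_trans _ (step_l1 stm exO n f _).
by apply: ler_sum => o _; exact: mobs_l1.
Qed.

Lemma left_inv_oom n x (v : O -> R) s :
  \sum_o' W n.+1 s o' * oom m W n x v o' =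
  \sum_s' mtrans m n s' x.2 s * mobs m n s' x.1 * \sum_o1 W n s' o1 * v o1.
Proof.
rewrite /oom; under eq_bigr do rewrite mulr_sumr.
rewrite exchange_big /= (bigD1 s) //= [X in _ + X]big1 => [|s' s's].
  by under eq_bigr do rewrite mulrA; rewrite -mulr_suml Wm eqxx mul1r addr0.
under eq_bigr do rewrite mulrA.
by rewrite -mulr_suml Wm eq_sym (negbTE s's) mul0r.
Qed.

Variables (ms : model) (g : seq (O * A) -> O -> A).

Definition step_err n :=
  psum g n (fun l => \sum_o \sum_o' `|err m W ms l (o, g l o) o'|).

Definition tot_err n :=
  \sum_o `|obs m [::] o - obs ms [::] o| + \sum_(j < n) step_err j.

Lemma obs_diff l x o' : obs m (x :: l) o' - obs ms (x :: l) o' =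
  oom m W (size l) x (fun o => obs m l o - obs ms l o) o' + err m W ms l x o'.
Proof. by rewrite errE oomB oom_obs; ring. Qed.

(** The induction is on decoded differences. Decoding by [W] cancels the emission that ends each
    operator ([left_inv_oom]), so that from one step to the next only an l1 contraction acts; each
    error pays [kappa] once, and the factors do not compound with the horizon. *)
Lemma bel_diff_le n :
  psum g n (fun l => \sum_s `|\sum_o W n s o * (obs m l o - obs ms l o)|)
  <= kappa * tot_err n.
Proof.
elim: n => [|n IH].
  by rewrite psum0 /tot_err big_ord0 addr0; exact: Wk.
rewrite /tot_err big_ord_recr /= addrA mulrDr.
apply: le_trans (lerD IH (lexx _)).
rewrite -psumZ -psumD psumS; apply: ler_psum => l ln.
pose u o := obs m l o - obs ms l o.
rewrite mulr_sumr.
apply: (@le_trans _ _ (\sum_o (\sum_s' `|\sum_s mtrans m n s (g l o) s' *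
    mobs m n s o * \sum_o1 W n s o1 * u o1| +
    kappa * \sum_o' `|err m W ms l (o, g l o) o'|))).
  apply: ler_sum => o _; set x := (o, g l o).
  apply: le_trans _ (lerD (lexx _) (Wk n.+1 _)).
  rewrite -big_split /=; apply: ler_sum => s _.
  have -> : \sum_o0 W n.+1 s o0 * (obs m (x :: l) o0 - obs ms (x :: l) o0) =
     \sum_o0 W n.+1 s o0 * oom m W n x u o0 +
     \sum_o0 W n.+1 s o0 * err m W ms l x o0.
    rewrite -big_split /=; apply: eq_bigr => o' _.
    by rewrite obs_diff mulrDr ln.
  apply: le_trans (ler_normD _ _) _; apply: lerD => //.
  by rewrite left_inv_oom.
by rewrite big_split /=; apply: lerD => //; exact: step_l1.
Qed.

Lemma step_err_ge0 n : 0 <= step_err n.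
Proof. by apply: psum_ge0 => l _; apply: sumr_ge0 => o _; exact: sumr_ge0. Qed.

(** The last operator is not decoded: its emission is a contraction applied to the decoded
    difference of the previous step, and the newest error enters without [kappa], which [1 <= kappa]
    absorbs. *)
Lemma obs_diff_le n : 1 <= kappa ->
  psum g n (fun l => \sum_o `|obs m l o - obs ms l o|) <= kappa * tot_err n.
Proof.
move=> k1; case: n => [|n].
  rewrite psum0 /tot_err big_ord0 addr0 ler_peMl //.
  exact: sumr_ge0.
rewrite /tot_err big_ord_recr /= addrA mulrDr.
apply: le_trans (lerD (bel_diff_le n) (lexx _)).
apply: le_trans _ (lerD (lexx _) (ler_peMl (step_err_ge0 n) k1)).
rewrite -psumD psumS; apply: ler_psum => l ln.
pose u o := obs m l o - obs ms l o.
apply: (@le_trans _ _ (\sum_o (\sum_o' `|oom m W n (o, g l o) u o'| +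
    \sum_o' `|err m W ms l (o, g l o) o'|))).
  apply: ler_sum => o _; rewrite -big_split /=; apply: ler_sum => o' _.
  by rewrite obs_diff ln; exact: ler_normD.
rewrite big_split /=; apply: lerD => //.
apply: le_trans _ (step_l1 stm exO n (g l) _).
by apply: ler_sum => o _; exact: mobs_l1.
Qed.

End Oom.
End Model.

(** * Hellinger distance of nonnegative functions *)

Section HellingerDistance.
Variables (R : realType) (Y : finType).
Implicit Types p q : Y -> R.

Definition hel2 p q : R := \sum_y (Num.sqrt (p y) - Num.sqrt (q y)) ^+ 2.

Lemma hel2_triangle p q s : hel2 p s <= 2 * hel2 p q + 2 * hel2 s q.
Proof.
rewrite /hel2 !mulr_sumr -big_split /=; apply: ler_sum => y _.
move: (Num.sqrt (p y)) (Num.sqrt (q y)) (Num.sqrt (s y)) => a b c.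
have := sqr_ge0 (a - b + (c - b)); nra.
Qed.

End HellingerDistance.

Section Hellinger.
Variable R : realType.

Lemma sqrtBM_norm (x y : R) : 0 <= x -> 0 <= y ->
  `|x - y| = `|Num.sqrt x - Num.sqrt y| * (Num.sqrt x + Num.sqrt y).
Proof.
move=> x0 y0.
rewrite -{1}(sqr_sqrtr x0) -{1}(sqr_sqrtr y0) subr_sqr normrM.
by rewrite [X in _ * X]ger0_norm // addr_ge0 ?sqrtr_ge0.
Qed.

(** Data processing, here the reverse triangle inequality between the Euclidean norms of the vectors
    of square roots. *)
Lemma hellinger_merge (I : finType) (p q : I -> R) :
  (forall i, 0 <= p i) -> (forall i, 0 <= q i) ->
  (Num.sqrt (\sum_i p i) - Num.sqrt (\sum_i q i)) ^+ 2 <=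
  \sum_i (Num.sqrt (p i) - Num.sqrt (q i)) ^+ 2.
Proof.
move=> p0 q0.
have sp : 0 <= \sum_i p i by exact: sumr_ge0.
have sq : 0 <= \sum_i q i by exact: sumr_ge0.
have cs := cauchy_schwarz_sum (fun i => Num.sqrt (p i)) (fun i => Num.sqrt (q i)).
have e1 : \sum_i Num.sqrt (p i) ^+ 2 = \sum_i p i.
  by apply: eq_bigr => i _; rewrite sqr_sqrtr.
have e2 : \sum_i Num.sqrt (q i) ^+ 2 = \sum_i q i.
  by apply: eq_bigr => i _; rewrite sqr_sqrtr.
have -> : \sum_i (Num.sqrt (p i) - Num.sqrt (q i)) ^+ 2 =
    \sum_i p i + \sum_i q i - 2 * \sum_i Num.sqrt (p i) * Num.sqrt (q i).
  rewrite -{1}e1 -{1}e2 mulr_sumr -big_split -sumrB /=.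
  by apply: eq_bigr => i _; ring.
rewrite e1 e2 in cs.
have : \sum_i Num.sqrt (p i) * Num.sqrt (q i) <=
       Num.sqrt (\sum_i p i) * Num.sqrt (\sum_i q i).
  rewrite -sqrtrM // -[leLHS]ger0_norm; last first.
    by apply: sumr_ge0 => i _; rewrite mulr_ge0 ?sqrtr_ge0.
  by rewrite -sqrtr_sqr ler_sqrt // mulr_ge0.
have := sqr_sqrtr sp; have := sqr_sqrtr sq.
by move: (Num.sqrt _) (Num.sqrt (\sum_i p i)) => u v; nra.
Qed.

(** Factor [x - y] through the square roots and apply Cauchy-Schwarz;
    [(sqrt x + sqrt y)^2 <= 2 x + 2 y] sums to at most [4 b]. *)
Lemma l1_sq_le_hellinger (I : finType) (x y : I -> R) b :
  (forall i, 0 <= x i) -> (forall i, 0 <= y i) ->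
  \sum_i x i <= b -> \sum_i y i <= b ->
  (\sum_i `|x i - y i|) ^+ 2 <=
  4 * b * \sum_i (Num.sqrt (x i) - Num.sqrt (y i)) ^+ 2.
Proof.
move=> x0 y0 xb yb.
under eq_bigr do rewrite sqrtBM_norm //.
apply: le_trans (cauchy_schwarz_sum _ _) _.
rewrite mulrC; under [X in _ * X]eq_bigr do rewrite real_normK ?num_real //.
apply: ler_wpM2r; first by apply: sumr_ge0 => i _; exact: sqr_ge0.
apply: (@le_trans _ _ (\sum_i (2 * x i + 2 * y i))).
  apply: ler_sum => i _.
  have := sqr_sqrtr (x0 i); have := sqr_sqrtr (y0 i).
  have := sqr_ge0 (Num.sqrt (x i) - Num.sqrt (y i)).
  by move: (Num.sqrt _) (Num.sqrt (x i)) => u v; nra.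
rewrite big_split /= -!mulr_sumr; lra.
Qed.

(* If [a = 0] the scaling factor [b / a] is [0]. *)
Lemma hellinger_rescale (I : finType) (x y : I -> R) a b :
  (forall i, 0 <= x i) -> (forall i, 0 <= y i) -> 0 <= b ->
  \sum_i x i = a -> \sum_i y i = b ->
  (\sum_i `|b / a * x i - y i|) ^+ 2 <=
  8 * b * ((Num.sqrt a - Num.sqrt b) ^+ 2 +
           \sum_i (Num.sqrt (x i) - Num.sqrt (y i)) ^+ 2).
Proof.
move=> x0 y0 b0 xa yb.
have a0 : 0 <= a by rewrite -xa sumr_ge0.
pose t := b / a; have t0 : 0 <= t by rewrite divr_ge0.
have h1 : (\sum_i `|t * x i - y i|) ^+ 2 <=
  4 * b * \sum_i (Num.sqrt (t * x i) - Num.sqrt (y i)) ^+ 2.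
  apply: l1_sq_le_hellinger => //; [by move=> i; rewrite mulr_ge0| |by rewrite yb].
  rewrite -mulr_sumr xa /t; have [->|a1] := eqVneq a 0; first by rewrite mulr0.
  by rewrite mulfVK.
(* [sqrt (t x) - sqrt y = (sqrt t - 1) sqrt x + (sqrt x - sqrt y)], and for nonzero [a] the first
   part has squared norm [(sqrt b - sqrt a)^2]. *)
have h2 : \sum_i (Num.sqrt (t * x i) - Num.sqrt (y i)) ^+ 2 <=
   2 * (Num.sqrt a - Num.sqrt b) ^+ 2 +
   2 * \sum_i (Num.sqrt (x i) - Num.sqrt (y i)) ^+ 2.
  apply: (@le_trans _ _ (2 * (Num.sqrt t - 1) ^+ 2 * a +
     2 * \sum_i (Num.sqrt (x i) - Num.sqrt (y i)) ^+ 2)).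
    rewrite -xa !mulr_sumr -big_split /=; apply: ler_sum => i _.
    have key (u v w : R) :
        (u * v - w) ^+ 2 <= 2 * (u - 1) ^+ 2 * v ^+ 2 + 2 * (v - w) ^+ 2.
      have := sqr_ge0 ((u - 1) * v - (v - w)); nra.
    have := key (Num.sqrt t) (Num.sqrt (x i)) (Num.sqrt (y i)).
    by rewrite sqr_sqrtr // -(sqrtrM (x i) t0).
  rewrite lerD2r -[2 * _ * a]mulrA ler_pM2l // /t.
  have [->|a1] := eqVneq a 0; first by rewrite mulr0; exact: sqr_ge0.
  have ap : 0 < a by rewrite lt_neqAle eq_sym a1.
  have -> : Num.sqrt b = Num.sqrt (b / a) * Num.sqrt a.
    by rewrite -sqrtrM -/t // mulfVK.
  rewrite -{2}(sqr_sqrtr a0).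
  move: (Num.sqrt _) (Num.sqrt _) => u v.
  by rewrite le_eqVlt; apply/orP; left; apply/eqP; ring.
rewrite -/t; apply: le_trans h1 _.
apply: le_trans (ler_wpM2l _ h2) _; first by rewrite mulr_ge0.
by rewrite le_eqVlt; apply/orP; left; apply/eqP; ring.
Qed.

End Hellinger.

(** * Operator errors bounded by Hellinger distances *)

Section ModelHellinger.
Variables (R : realType) (S A O : finType).
Local Notation model := (model R S A O).
Hypothesis exO : exists o : O, True.
Implicit Types (m ms : model) (g : seq (O * A) -> O -> A).

Definition hel m ms g n :=
  psum g n (fun l => (Num.sqrt (lik m l) - Num.sqrt (lik ms l)) ^+ 2).

Lemma hel_ge0 m ms g n : 0 <= hel m ms g n.
Proof. by apply: psum_ge0 => l _; exact: sqr_ge0. Qed.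

Lemma hel_next m ms : stochastic m -> stochastic ms -> forall l (f : O -> A),
  (Num.sqrt (lik m l) - Num.sqrt (lik ms l)) ^+ 2 <=
  \sum_o (Num.sqrt (lik m ((o, f o) :: l)) - Num.sqrt (lik ms ((o, f o) :: l))) ^+ 2.
Proof.
move=> stm sts l f; rewrite -(sum_obs stm) // -(sum_obs sts) //.
have := hellinger_merge (obs_ge0 stm l) (obs_ge0 sts l).
by under [X in _ <= X -> _]eq_bigr => o _ do
  rewrite -(lik_cons stm (o, f o) l) -(lik_cons sts (o, f o) l).
Qed.

Lemma hel_le m ms g : stochastic m -> stochastic ms ->
  {homo hel m ms g : n p / (n <= p)%N >-> n <= p}.
Proof.
move=> stm sts; apply: homo_leq => // [x y z|n]; first exact: le_trans.
by rewrite /hel psumS; apply: ler_psum => l _; exact: hel_next.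
Qed.

Variables (m : model) (W : nat -> S -> O -> R) (kappa : R).
Hypotheses (stm : stochastic m) (Wm : left_inv m W) (Wk : l1_bound W kappa).
Hypothesis k1 : 1 <= kappa.
Variable ms : model.
Hypothesis sts : stochastic ms.

Lemma init_le_hel g : (\sum_o `|obs m [::] o - obs ms [::] o|) ^+ 2 <=
  4 * hel m ms g 1.
Proof.
rewrite /hel psumS psum0 -[4]mulr1.
under [X in _ <= _ * X]eq_bigr do rewrite !lik_cons //=.
apply: l1_sq_le_hellinger; try by move=> o; exact: obs_ge0.
  by rewrite sum_obs // lik_nil.
by rewrite sum_obs // lik_nil.
Qed.

(** The factor [t] brings the law of [m] to the mass of [ms] on [l], which puts [lik ms l] alone in
    front. Since the operator sends [obs m l] to the next observations under [m], the error is the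
    operator applied to [obs ms l - t * obs m l], which costs [kappa], plus [t * z - zs]; hence
    [2 * kappa * D], and [32 = 4 * 8]. This is the second loss of [kappa], after the telescoping. *)
Lemma err_sq_le l (f : O -> A) :
  (\sum_o \sum_o' `|err m W ms l (o, f o) o'|) ^+ 2 <=
  32 * kappa ^+ 2 * lik ms l *
  ((Num.sqrt (lik m l) - Num.sqrt (lik ms l)) ^+ 2 +
   \sum_o \sum_o' (Num.sqrt (obs m ((o, f o) :: l) o') -
                   Num.sqrt (obs ms ((o, f o) :: l) o')) ^+ 2).
Proof.
pose z (p : O * O) := obs m ((p.1, f p.1) :: l) p.2.
pose zs (p : O * O) := obs ms ((p.1, f p.1) :: l) p.2.
pose t := lik ms l / lik m l.
have pairE (F : O * O -> R) : \sum_p F p = \sum_o \sum_o' F (o, o').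
  by rewrite pair_bigA /=; apply: eq_bigr => -[].
have zE o : obs m l o = \sum_o' z (o, o').
  by rewrite /z /= sum_obs // lik_cons.
have zsE o : obs ms l o = \sum_o' zs (o, o').
  by rewrite /zs /= sum_obs // lik_cons.
pose D := \sum_o \sum_o' `|t * z (o, o') - zs (o, o')|.
have k0 : 0 <= kappa by exact: le_trans k1.
have D0 : 0 <= D by apply: sumr_ge0 => o _; exact: sumr_ge0.
have errD : \sum_o \sum_o' `|err m W ms l (o, f o) o'| <= 2 * kappa * D.
  apply: (@le_trans _ _ (kappa * D + D)); last first.
    rewrite -subr_ge0 (_ : _ - _ = (kappa - 1) * D); last by ring.
    by rewrite mulr_ge0 ?subr_ge0.
  apply: (@le_trans _ _ (\sum_o \sum_o' (
     `|oom m W (size l) (o, f o) (fun o => obs ms l o - t * obs m l o) o'| +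
     `|t * z (o, o') - zs (o, o')|))).
    apply: ler_sum => o _; apply: ler_sum => o' _.
    rewrite errE oomB oomZ (oom_obs Wm).
    apply: le_trans _ (ler_normD _ _); rewrite le_eqVlt; apply/orP; left.
    by apply/eqP; congr `|_|; rewrite /z /zs /=; ring.
  under eq_bigr do rewrite big_split /=.
  rewrite big_split /=; apply: lerD => //.
  apply: le_trans (oom_l1 stm Wk exO _ f _) _.
  apply: ler_wpM2l => //; apply: ler_sum => o _.
  rewrite zE zsE mulr_sumr -sumrB.
  apply: le_trans (ler_norm_sum _ _ _) _.
  by apply: ler_sum => o' _; rewrite distrC.
have errS0 : 0 <= \sum_o \sum_o' `|err m W ms l (o, f o) o'|.
  by apply: sumr_ge0 => o _; exact: sumr_ge0.
apply: (@le_trans _ _ ((2 * kappa * D) ^+ 2)).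
  by rewrite ler_pXn2r ?nnegrE // !mulr_ge0.
have := @hellinger_rescale R _ z zs (lik m l) (lik ms l).
have Dpair : D = \sum_p `|t * z p - zs p|.
  by rewrite /D pair_big /=; apply: eq_bigr => -[].
have -> : \sum_o \sum_o' (Num.sqrt (obs m ((o, f o) :: l) o') -
    Num.sqrt (obs ms ((o, f o) :: l) o')) ^+ 2 =
    \sum_p (Num.sqrt (z p) - Num.sqrt (zs p)) ^+ 2.
  by rewrite pairE.
rewrite -/t -Dpair => hD.
have {}hD := hD (fun p => obs_ge0 stm _ _) (fun p => obs_ge0 sts _ _) (lik_ge0 sts l).
have zS : \sum_p z p = lik m l.
  by rewrite pairE -sum_obs //; apply: eq_bigr => o _; rewrite zE.
have zsS : \sum_p zs p = lik ms l.
  by rewrite pairE -(sum_obs sts) //; apply: eq_bigr => o _; rewrite zsE.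
have {}hD := hD zS zsS.
rewrite exprMn exprMn.
apply: le_trans (ler_wpM2l _ hD) _; first by rewrite mulr_ge0 ?sqr_ge0.
by rewrite le_eqVlt; apply/orP; left; apply/eqP; ring.
Qed.

(** An error at step [n] compares laws of the two observations that follow, hence the length [n.+2];
    the two Hellinger terms, at lengths [n] and [n.+2], double 32 to 64. *)
Lemma psum_err_sq g n N : (n.+2 <= N)%N ->
  psum g n (fun l => (\sum_o \sum_o' `|err m W ms l (o, g l o) o'|) ^+ 2 / lik ms l)
  <= 64 * kappa ^+ 2 * hel m ms g N.
Proof.
move=> nN.
have k2 : 0 <= kappa ^+ 2 by exact: sqr_ge0.
have -> : 64 * kappa ^+ 2 * hel m ms g N =
   32 * kappa ^+ 2 * (hel m ms g N + hel m ms g N) by ring.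
apply: (@le_trans _ _ (32 * kappa ^+ 2 * (hel m ms g n + hel m ms g n.+2))).
  rewrite {2}/hel !psumS -psumD -psumZ; apply: ler_psum => l _.
  have [l0|l1] := eqVneq (lik ms l) 0.
    rewrite l0 invr0 mulr0; apply: mulr_ge0; first by rewrite mulr_ge0.
    apply: addr_ge0; first exact: sqr_ge0.
    by apply: sumr_ge0 => o _; apply: sumr_ge0 => o' _; exact: sqr_ge0.
  have lp : 0 < lik ms l by rewrite lt_neqAle eq_sym l1 lik_ge0.
  rewrite ler_pdivrMr //; apply: le_trans (err_sq_le l (g l)) _.
  rewrite le_eqVlt; apply/orP; left; apply/eqP.
  rewrite mulrAC; congr (_ * (_ + _) * _).
  apply: eq_bigr => o _; apply: eq_bigr => o' _.
  by rewrite (lik_cons stm (o', _)) (lik_cons sts (o', _)).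
apply: ler_wpM2l; first by rewrite mulr_ge0.
apply: lerD; apply: hel_le => //; exact: leq_trans (leqW (leqnSn n)) nN.
Qed.

End ModelHellinger.

(** * Decoupling the policy from the model *)

Section Decoupling.
Variables (R : realType) (S A O Pi : finType).
Local Notation model := (model R S A O).
Hypothesis exO : exists o : O, True.
Variables (gs : Pi -> seq (O * A) -> O -> A) (q : Pi -> R).
Hypotheses (q0 : forall p, 0 <= q p) (q1 : \sum_p q p = 1).
Variable ms : model.
Hypothesis sts : stochastic ms.
Variable kappa : R.
Hypothesis k1 : 1 <= kappa.

(** The weight of [l] and of the choice of [a] at [o] under a policy drawn from [q]. The probability
    of [o] itself is left out: it already sits in the functionals [errw]. *)
Definition visit n o a (l : n.-tuple (O * A)) :=
  \sum_p q p * (polw R (gs p) l * (gs p l o == a)%:R * lik ms l).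

Lemma visit_ge0 n o a (l : n.-tuple (O * A)) : 0 <= visit o a l.
Proof.
apply: sumr_ge0 => p _; apply: mulr_ge0 => //; apply: mulr_ge0.
  by rewrite mulr_ge0 ?polw_ge0.
exact: lik_ge0.
Qed.

Lemma visit_sum n (F : O -> A -> seq (O * A) -> R) :
  \sum_o \sum_a \sum_(l : n.-tuple (O * A)) visit o a l * F o a l =
  \sum_p q p * psum (gs p) n (fun l => lik ms l * \sum_o F o (gs p l o) l).
Proof.
have -> : \sum_p q p * psum (gs p) n (fun l => lik ms l * \sum_o F o (gs p l o) l)
  = \sum_p \sum_o \sum_a \sum_(l : n.-tuple (O * A))
      q p * (polw R (gs p) l * (gs p l o == a)%:R * lik ms l) * F o a l.
  apply: eq_bigr => p _.
  under [RHS]eq_bigr do rewrite exchange_big /=.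
  rewrite exchange_big /psum mulr_sumr /=; apply: eq_bigr => l _.
  rewrite !mulr_sumr; apply: eq_bigr => o _.
  rewrite (bigD1 (gs p l o)) //= eqxx big1 ?addr0 => [|a ag].
    by rewrite mulr1; ring.
  by rewrite eq_sym (negbTE ag) mulr0 mul0r mulr0 mul0r.
rewrite [RHS]exchange_big /=; apply: eq_bigr => o _.
rewrite [RHS]exchange_big /=; apply: eq_bigr => a _.
rewrite [RHS]exchange_big /=; apply: eq_bigr => l _.
by rewrite mulr_suml.
Qed.

(** Crude bound for the places where leverage scores say nothing: histories of likelihood 0 and
    triples whose [visit] weight is 0. *)
Lemma err_le_lik m W l x o' : stochastic m -> left_inv m W -> l1_bound W kappa ->
  `|err m W ms l x o'| <= (kappa + 1) * lik ms l.
Proof.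
move=> stm Wm Wk; case: x => o a.
rewrite errE mulrDl mul1r; apply: le_trans (ler_normB _ _) _; apply: lerD.
  apply: (@le_trans _ _ (kappa * \sum_o1 `|obs ms l o1|)).
    apply: le_trans _ (oom_l1 stm Wk exO (size l) (fun=> a) (obs ms l)).
    rewrite (bigD1 o) //= (bigD1 o') //= -addrA lerDl addr_ge0 //.
      exact: sumr_ge0.
    by apply: sumr_ge0 => o1 _; exact: sumr_ge0.
  rewrite ler_wpM2l ?(le_trans ler01) // -sum_obs //.
  by apply: ler_sum => o1 _; rewrite ger0_norm // obs_ge0.
rewrite ger0_norm ?obs_ge0 //.
have h (k : O -> R) i : (forall j, 0 <= k j) -> k i <= \sum_j k j.
  by move=> k0; rewrite (bigD1 i) //= lerDl sumr_ge0.
apply: le_trans (h (obs ms _) _ (obs_ge0 sts _)) _.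
rewrite sum_obs // lik_cons // -[leRHS]sum_obs //.
exact: h (obs_ge0 sts _).
Qed.

(* [Gamma] collects the leverage terms: it does not depend on the model [m],
   and its average under [q] counts the [O^2 A] linear functionals of the
   [S]-dimensional belief. The second term is, by [psum_err_sq], a Hellinger
   distance in which policy and model are independent. *)
Lemma decouple_step n (lambda : R) : 0 < lambda ->
  exists Gamma : Pi -> R,
    \sum_p q p * Gamma p <=
      #|O|%:R ^+ 2 * #|A|%:R * #|S|%:R / (2 * lambda) /\
    forall m W, stochastic m -> left_inv m W -> l1_bound W kappa ->
      forall p, step_err m W ms (gs p) n <= Gamma p + lambda / 2 *
        \sum_p' q p' * psum (gs p') n (fun l =>
          (\sum_o \sum_o' `|err m W ms l (o, gs p' l o) o'|) ^+ 2 / lik ms l).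
Proof.
move=> lam0.
pose xb (l : n.-tuple (O * A)) s := bel ms l s / lik ms l.
have lev (x : O * A) : exists l : n.-tuple (O * A) -> R, [/\ forall i, 0 <= l i,
    forall (w : S -> R) i, 0 < visit x.1 x.2 i ->
      (\sum_s w s * xb i s) ^+ 2 <=
        l i * \sum_j visit x.1 x.2 j * (\sum_s w s * xb j s) ^+ 2 &
    \sum_i visit x.1 x.2 i * l i <= #|S|%:R].
  by apply: leverage_scores => l; exact: visit_ge0.
have {lev} [lv lvP] := choice lev.
(* Where [visit] vanishes the score inequality is void and the crude bound [kappa + 1] is used; it
   costs nothing in the [q]-average. The value 0 at other lengths is never reached. *)
pose L o a (l : seq (O * A)) :=
  if insub l is Some l' then
    (if 0 < @visit n o a l' then lv (o, a) l' / (2 * lambda) else kappa + 1)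
  else 0.
have LE o a (l : n.-tuple (O * A)) :
    L o a l = if 0 < visit o a l then lv (o, a) l / (2 * lambda) else kappa + 1.
  by rewrite /L valK.
(* The factor [#|O|] counts the next observations [o'], of which the score is independent; with the
   sums over [o] and [a] this makes [O^2 A] functionals. *)
exists (fun p => psum (gs p) n (fun l =>
   lik ms l * \sum_o #|O|%:R * L o (gs p l o) l)); split.
  rewrite -(visit_sum n (fun o a l => #|O|%:R * L o a l)).
  apply: (@le_trans _ _ (\sum_(o : O) \sum_(a : A) #|O|%:R * (#|S|%:R / (2 * lambda)))).
    apply: ler_sum => o _; apply: ler_sum => a _.
    have [_ _ h] := lvP (o, a).
    under eq_bigr do rewrite mulrCA.
    rewrite -mulr_sumr ler_wpM2l ?ler0n //.
    rewrite ler_pdivlMr; last by rewrite mulr_gt0.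
    apply: le_trans _ h; rewrite mulr_suml; apply: ler_sum => l _ /=.
    rewrite LE; case: ifP => vl.
      by rewrite -mulrA mulfVK // gt_eqF // mulr_gt0.
    have -> : visit o a l = 0.
      by apply/eqP; rewrite eq_le visit_ge0 andbT leNgt vl.
    by rewrite !mul0r.
  have -> : \sum_(o : O) \sum_(a : A) #|O|%:R * (#|S|%:R / (2 * lambda)) =
      #|O|%:R * (#|A|%:R * (#|O|%:R * (#|S|%:R / (2 * lambda)))) :> R.
    by rewrite !sumr_const !mulr_natl.
  by rewrite expr2 !mulrA [#|O|%:R * #|A|%:R * _]mulrAC.
move=> m W stm Wm Wk p.
pose e o a o' (l : n.-tuple (O * A)) := \sum_s errw m W ms n (o, a) o' s * xb l s.
have errE' o a o' (l : n.-tuple (O * A)) :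
    err m W ms l (o, a) o' = lik ms l * e o a o' l.
  have [l0|l1] := eqVneq (lik ms l) 0.
    rewrite l0 mul0r; apply/eqP; rewrite -normr_le0.
    by have := err_le_lik l (o, a) o' stm Wm Wk; rewrite l0 mulr0.
  rewrite /e mulr_sumr; apply: eq_bigr => s _.
  by rewrite /xb size_tuple mulrCA; congr (_ * _); rewrite mulrC mulfVK.
pose N o a o' := \sum_l visit o a l * e o a o' l ^+ 2.
have N0 o a o' : 0 <= N o a o'.
  by apply: sumr_ge0 => l _; rewrite mulr_ge0 ?visit_ge0 ?sqr_ge0.
pose Ntot := \sum_o \sum_a \sum_o' N o a o'.
have ptw o a o' (l : n.-tuple (O * A)) : lik ms l * `|e o a o' l| <=
    lik ms l * (L o a l + lambda / 2 * N o a o').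
  have [l0|l1] := eqVneq (lik ms l) 0; first by rewrite l0 !mul0r.
  have lp : 0 < lik ms l by rewrite lt_neqAle eq_sym l1 lik_ge0.
  rewrite ler_pM2l // LE; case: ifP => vl; last first.
    apply: ler_wpDr; first by rewrite mulr_ge0 ?N0 // ltW // divr_gt0.
    have := err_le_lik l (o, a) o' stm Wm Wk.
    by rewrite errE' normrM (ger0_norm (ltW lp)) mulrC ler_pM2r.
  have [lv0 /(_ (errw m W ms n (o, a) o') l vl) h _] := lvP (o, a).
  have {h} : e o a o' l ^+ 2 <= lv (o, a) l * N o a o' by [].
  rewrite -[_ ^+ 2]real_normK ?num_real //.
  have := lv0 l; have := N0 o a o'.
  move: (lv (o, a) l) (N o a o') `|e o a o' l| (normr_ge0 (e o a o' l)) => u v w w0 v0 u0 h.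
  (* AM-GM: from [w^2 <= u v] follows [2 lambda w <= u + lambda^2 v]. *)
  rewrite -(@ler_pM2l _ (2 * lambda)) ?mulr_gt0 // mulrDr.
  rewrite [2 * lambda * (u / _)]mulrC mulfVK; last by rewrite gt_eqF // mulr_gt0.
  have -> : 2 * lambda * (lambda / 2 * v) = lambda ^+ 2 * v by field.
  rewrite -(@ler_pXn2r _ 2) ?nnegrE //; last first.
  - by rewrite addr_ge0 // mulr_ge0 // sqr_ge0.
  - by rewrite !mulr_ge0 // ltW.
  have h2 := ler_wpM2l (sqr_ge0 lambda) h.
  have := sqr_ge0 (u - lambda ^+ 2 * v).
  nra.
have NtotE : Ntot <= \sum_p' q p' * psum (gs p') n (fun l =>
      (\sum_o \sum_o' `|err m W ms l (o, gs p' l o) o'|) ^+ 2 / lik ms l).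
  pose e2 o a (l : seq (O * A)) :=
    \sum_o' (err m W ms l (o, a) o' / lik ms l) ^+ 2.
  have e2E o a (l : n.-tuple (O * A)) : lik ms l * e2 o a l =
     lik ms l * \sum_o' e o a o' l ^+ 2.
    have [->|l1] := eqVneq (lik ms l) 0; first by rewrite !mul0r.
    congr (_ * _); apply: eq_bigr => o' _; rewrite errE'.
    by rewrite mulrAC mulfV // mul1r.
  have -> : Ntot = \sum_o \sum_a \sum_(l : n.-tuple (O * A)) visit o a l * e2 o a l.
    apply: eq_bigr => o _; apply: eq_bigr => a _.
    rewrite /N exchange_big /=; apply: eq_bigr => l _.
    rewrite -mulr_sumr /visit !mulr_suml; apply: eq_bigr => p' _.
    by rewrite -!mulrA; congr (_ * (_ * (_ * _))); rewrite e2E.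
  rewrite visit_sum; apply: ler_sum => p' _; apply: ler_wpM2l => //.
  apply: ler_psum => l _.
  have [->|l1] := eqVneq (lik ms l) 0; first by rewrite mul0r invr0 mulr0.
  have lp : 0 < lik ms l by rewrite lt_neqAle eq_sym l1 lik_ge0.
  have sqle (I : finType) (k : I -> R) : (forall i, 0 <= k i) ->
      \sum_i k i ^+ 2 <= (\sum_i k i) ^+ 2.
    move=> k0; rewrite [leRHS]expr2 mulr_suml; apply: ler_sum => i _.
    by rewrite expr2 ler_wpM2l // (bigD1 i) //= lerDl sumr_ge0.
  apply: (@le_trans _ _ ((\sum_o \sum_o' `|err m W ms l (o, gs p' l o) o'| ^+ 2) / lik ms l)).
    rewrite !mulr_sumr mulr_suml; apply: ler_sum => o _.
    rewrite /e2 mulr_sumr mulr_suml; apply: ler_sum => o' _.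
    rewrite real_normK ?num_real // exprMn exprVn le_eqVlt; apply/orP; left.
    by apply/eqP; field.
  rewrite ler_wpM2r ?invr_ge0 ?(ltW lp) //.
  apply: (@le_trans _ _ (\sum_o (\sum_o' `|err m W ms l (o, gs p' l o) o'|) ^+ 2)).
    by apply: ler_sum => o _; exact: sqle.
  by apply: sqle => o; exact: sumr_ge0.
apply: le_trans _ (lerD (lexx _) (ler_wpM2l _ NtotE)); last first.
  by rewrite ltW // divr_gt0.
rewrite -[lambda / 2 * Ntot]mulr1 -[X in _ * X](psum_lik sts exO (gs p) n).
rewrite -psumZ -psumD.
apply: ler_sum => l _; apply: ler_wpM2l; first exact: polw_ge0.
have -> : lik ms l * \sum_o #|O|%:R * L o (gs p l o) l +
    lambda / 2 * Ntot * lik ms l =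
    lik ms l * (\sum_o \sum_(o' : O) L o (gs p l o) l + lambda / 2 * Ntot).
  rewrite mulrDr [_ * lik _ _]mulrC; congr (_ * _ + _).
  by apply: eq_bigr => o _; rewrite sumr_const mulr_natl.
apply: (@le_trans _ _ (\sum_o \sum_o' lik ms l *
     (L o (gs p l o) l + lambda / 2 * N o (gs p l o) o'))).
  apply: ler_sum => o _; apply: ler_sum => o' _.
  by rewrite errE' normrM (ger0_norm (lik_ge0 sts l)); exact: ptw.
under eq_bigr do rewrite -mulr_sumr big_split /=.
rewrite -mulr_sumr big_split /= ler_wpM2l ?lik_ge0 // lerD2l.
under eq_bigr do rewrite -mulr_sumr.
rewrite -mulr_sumr ler_wpM2l //; first by rewrite ltW // divr_gt0.
(* The played action depends on [l]; summing over all actions gives a bound free of [l] and [p]. *)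
apply: ler_sum => o _; rewrite (bigD1 (gs p l o)) //= lerDl.
by apply: sumr_ge0 => a _; exact: sumr_ge0.
Qed.

Lemma decouple H (lambda : R) : 0 < lambda -> (0 < #|A|)%N -> (0 < #|S|)%N ->
  exists Gamma : Pi -> R,
    \sum_p q p * Gamma p <=
      H.+1%:R * (#|O|%:R ^+ 2 * #|A|%:R * #|S|%:R) / (2 * lambda) /\
    forall m W, stochastic m -> left_inv m W -> l1_bound W kappa ->
      forall p, psum (gs p) H (fun l => \sum_o `|obs m l o - obs ms l o|) <=
        kappa * (Gamma p + 32 * H.+1%:R * kappa ^+ 2 * lambda *
          \sum_p' q p' * hel m ms (gs p') H.+1).
Proof.
move=> lam0 A0 S0.
have {}O0 : (0 < #|O|)%N by case: exO => o _; apply/card_gt0P; exists o.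
have [G GP] := choice (fun n => decouple_step n lam0).
exists (fun p => 1 / (2 * lambda) + \sum_(j < H) G j p); split.
  under eq_bigr do rewrite mulrDr.
  rewrite big_split /= -mulr_suml q1 mul1r.
  under eq_bigr do rewrite mulr_sumr.
  rewrite exchange_big /=.
  set c := #|O|%:R ^+ 2 * #|A|%:R * #|S|%:R.
  (* The initial term [1 / (2 * lambda)] is counted as one more step, since [1 <= c]. *)
  apply: (@le_trans _ _ (c / (2 * lambda) + \sum_(j < H) c / (2 * lambda))).
    apply: lerD; last by apply: ler_sum => j _; have [] := GP j.
    rewrite ler_pM2r ?invr_gt0 ?mulr_gt0 // /c.
    by rewrite -natrX -!natrM ler1n !muln_gt0 O0 A0 S0.
  rewrite sumr_const card_ord -mulrS.
  have -> // : H.+1%:R * c / (2 * lambda) = c / (2 * lambda) *+ H.+1.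
  by rewrite -(mulrA _ c) mulr_natl.

move=> m W stm Wm Wk p.
apply: le_trans (obs_diff_le stm Wm Wk exO ms (gs p) H k1) _.
apply: ler_wpM2l; first exact: le_trans k1.
set E := \sum_p' q p' * hel m ms (gs p') H.+1.
have E0 : 0 <= E by apply: sumr_ge0 => p' _; rewrite mulr_ge0 // hel_ge0.
(* AM-GM as in the other steps, with [D ^+ 2 <= 4 * E] in place of a leverage inequality. *)
have init : \sum_o `|obs m [::] o - obs ms [::] o| <= 1 / (2 * lambda) + 2 * lambda * E.
  set D := \sum_o _.
  have D2 : D ^+ 2 <= 4 * E.
    have -> : D ^+ 2 = \sum_p' q p' * D ^+ 2 by rewrite -mulr_suml q1 mul1r.
    rewrite /E mulr_sumr; apply: ler_sum => p' _.
    rewrite [4 * _]mulrCA ler_wpM2l //; apply: le_trans (init_le_hel exO stm sts (gs p')) _.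
    by rewrite ler_wpM2l //; exact: hel_le.
  have -> : 1 / (2 * lambda) + 2 * lambda * E = (1 + lambda ^+ 2 * (4 * E)) / (2 * lambda).
    by field; rewrite gt_eqF.
  rewrite ler_pdivlMr ?mulr_gt0 //.
  have := ler_wpM2l (sqr_ge0 lambda) D2; have := sqr_ge0 (lambda * D - 1).
  move: (D) (E) => u v; nra.
have step j : (j < H)%N -> step_err m W ms (gs p) j <=
    G j p + 32 * kappa ^+ 2 * lambda * E.
  move=> jH; have [_ /(_ m W stm Wm Wk p) h] := GP j.
  apply: le_trans h _; rewrite lerD2l.
  have -> : 32 * kappa ^+ 2 * lambda * E = lambda / 2 * (64 * kappa ^+ 2 * E).
    by field.
  apply: ler_wpM2l; first by rewrite ltW // divr_gt0.
  rewrite /E mulr_sumr; apply: ler_sum => p' _.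
  rewrite [64 * _ * _]mulrCA ler_wpM2l //.
  exact: psum_err_sq.
rewrite /tot_err.
apply: le_trans (lerD init (ler_sum _ (fun (j : 'I_H) _ => step j (ltn_ord j)))) _.
rewrite big_split /= sumr_const card_ord -[X in _ + (_ + X) <= _]mulr_natl.
have k2 : 1 <= kappa ^+ 2 by rewrite exprn_ege1.
have lE : 0 <= lambda * E by rewrite mulr_ge0 // ltW.
have key : 2 * lambda * E + H%:R * (32 * kappa ^+ 2 * lambda * E) <=
    32 * H.+1%:R * kappa ^+ 2 * lambda * E.
  rewrite -[H.+1%:R]natr1 -subr_ge0.
  have -> : 32 * (H%:R + 1) * kappa ^+ 2 * lambda * E -
     (2 * lambda * E + H%:R * (32 * kappa ^+ 2 * lambda * E)) =
     (32 * kappa ^+ 2 - 2) * (lambda * E) by ring.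
  by rewrite mulr_ge0 // subr_ge0; lra.
rewrite addrACA lerD2l; exact: key.
Qed.

End Decoupling.

(** * From trajectories to histories *)

Lemma big_ffun_codom (V : nmodType) (X : finType) n (F : seq X -> V) :
  \sum_(f : {ffun 'I_n -> X}) F (codom f) = \sum_(t : n.-tuple X) F t.
Proof.
rewrite (reindex (fun t : n.-tuple X => [ffun i => tnth t i])) /=.
  apply: eq_bigr => t _; congr F; rewrite codomE.
  rewrite -[RHS]map_tnth_enum; apply: eq_map => i; exact: ffunE.
exists (fun f : {ffun 'I_n -> X} => [tuple f i | i < n]) => [t _|f _].
  by apply: eq_from_tnth => i; rewrite tnth_mktuple ffunE.
by apply/ffunP => i; rewrite ffunE tnth_mktuple.
Qed.

Lemma big_tuple_rev (V : nmodType) (X : finType) n (F : seq X -> V) :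
  \sum_(t : n.-tuple X) F (rev t) = \sum_(t : n.-tuple X) F t.
Proof.
rewrite [RHS](reindex (fun t : n.-tuple X => [tuple of rev t])) //=.
exists (fun t : n.-tuple X => [tuple of rev t]) => t _; apply: val_inj => /=;
  exact: revK.
Qed.

Section Bridge.
Variables (R : realType) (S A O : finType) (H : nat).
Variables (s0 : S) (x0 : O * A).
Local Notation model := (model R S A O).
Local Notation traj := (traj A O H.+1).
Local Notation policy := (policy A O H.+1).

(** Past the horizon [inord] falls back on step 0, so that stochastic and revealing kernels stay so
    at every natural index. *)
Definition to_model (b1 : S -> R) (Tr : 'I_H.+1 -> S -> A -> S -> R)
    (Zo : 'I_H.+1 -> S -> O -> R) : model :=
  Model b1 (fun n => Tr (inord n)) (fun n => Zo (inord n)).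

Definition pol_act (p : policy) (l : seq (O * A)) (o : O) : A :=
  p (inord (size l))
    ([tuple nth x0 (rev l) i | i < (inord (size l) : 'I_H.+1)], o).

Definition rtraj (tau : traj) := rev (codom tau).

Lemma sum_rtraj (V : nmodType) (F : seq (O * A) -> V) :
  \sum_(tau : traj) F (rtraj tau) = \sum_(t : H.+1.-tuple (O * A)) F t.
Proof.
by rewrite (big_ffun_codom _ (fun l => F (rev l))) big_tuple_rev.
Qed.

Lemma nth_codom_ord (X : eqType) (y0 : X) n (f : 'I_n -> X) (i : 'I_n) :
  nth y0 (codom f) i = f i.
Proof.
by rewrite codomE (nth_map i) ?size_enum_ord // nth_ord_enum.
Qed.

Lemma size_codom_ord (X : eqType) n (f : 'I_n -> X) : size (codom f) = n.
Proof. by rewrite size_codom card_ord. Qed.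

Lemma pol_act_hist p l o (h : 'I_H.+1) : size l = h ->
  pol_act p l o = p h ([tuple nth x0 (rev l) i | i < h], o).
Proof.
move=> lh; have e : inord (size l) = h by rewrite lh inord_val.
by rewrite /pol_act e.
Qed.

Lemma polw_rev (g : seq (O * A) -> O -> A) s :
  polw R g (rev s) = \prod_(i < size s)
    (g (rev (take i s)) (nth x0 s i).1 == (nth x0 s i).2)%:R.
Proof.
elim/last_ind: s => [|s x IH]; first by rewrite big_ord0.
rewrite rev_rcons /= IH size_rcons big_ord_recr /= mulrC; congr (_ * _).
  apply: eq_bigr => i _.
  by rewrite nth_rcons ltn_ord -cats1 takel_cat // ltnW.
by rewrite nth_rcons ltnn eqxx -cats1 take_size_cat.
Qed.

Lemma pol_probE p (tau : traj) :
  pol_prob R p tau = polw R (pol_act p) (rtraj tau).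
Proof.
rewrite /rtraj polw_rev size_codom_ord /pol_prob; apply: eq_bigr => h _.
rewrite nth_codom_ord (@pol_act_hist _ _ _ h); last first.
  by rewrite size_rev size_take size_codom_ord ltn_ord.
congr ((p h (_, _) == _)%:R); apply: eq_from_tnth => i.
rewrite !tnth_mktuple revK nth_take //.
by rewrite -[LHS](nth_codom_ord x0).
Qed.

(* Newest state first. *)
Fixpoint pathw (m : model) (q : seq S) (l : seq (O * A)) : R :=
  match l with
  | x :: l' => mtrans m (size l') (head s0 (behead q)) x.2 (head s0 q) *
      mobs m (size l') (head s0 (behead q)) x.1 * pathw m (behead q) l'
  | [::] => minit m (head s0 q)
  end.

Lemma bel_path m l s :
  bel m l s = \sum_(q : (size l).-tuple S) pathw m (s :: q) l.
Proof.
elim: l s => [|x l IH] s /=.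
  by rewrite (big_tuple_nil (fun q => minit m s)).
rewrite (big_tuple_cons _ (fun q => mtrans m (size l) (head s0 q) x.2 s *
   mobs m (size l) (head s0 q) x.1 * pathw m q l)) /=.
by apply: eq_bigr => s' _; rewrite IH mulr_sumr.
Qed.

Lemma pathw_rev m q s : size q = (size s).+1 ->
  pathw m (rev q) (rev s) = minit m (nth s0 q 0) *
   \prod_(i < size s) (mtrans m i (nth s0 q i) (nth x0 s i).2 (nth s0 q i.+1) *
     mobs m i (nth s0 q i) (nth x0 s i).1).
Proof.
elim/last_ind: s q => [|s x IH] q.
  by case: q => [//|y [|//]] _; rewrite big_ord0 mulr1.
case/lastP: q => [//|q y]; rewrite !size_rcons => -[qs].
rewrite !rev_rcons /= IH // size_rev big_ord_recr /= [LHS]mulrC [RHS]mulrA.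
have hd : head s0 (rev q) = nth s0 q (size s).
  by rewrite -nth0 nth_rev qs // subn1.
have n0 : nth s0 (rcons q y) 0 = nth s0 q 0 by rewrite nth_rcons qs.
congr (_ * _); last first.
  by rewrite hd !nth_rcons qs ltnSn !ltnn !eqxx.
rewrite n0; congr (_ * _); apply: eq_bigr => i _.
have iq : (i < size q)%N by rewrite qs ltnS ltnW.
have iq1 : (i.+1 < size q)%N by rewrite qs ltnS.
by rewrite !nth_rcons iq iq1 ltn_ord.
Qed.

(** [env_prob] ends with the last emission, so it is [obs] of the history without its newest pair;
    its sum over state paths is the expansion of the belief recursion. *)
Lemma env_probE b1 Tr Zo (tau : traj) x l : rtraj tau = x :: l ->
  env_prob b1 Tr Zo tau = obs (to_model b1 Tr Zo) l x.1.
Proof.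
move=> taul; set m := to_model _ _ _.
have ctau : codom tau = rcons (rev l) x.
  by rewrite -(revK (codom tau)) -/(rtraj tau) taul rev_cons.
have sl : size l = H.
  have := size_codom_ord tau; rewrite ctau size_rcons size_rev; by case.
have tauE (i : 'I_H.+1) : tau i = nth x0 (rcons (rev l) x) i.
  by rewrite -ctau nth_codom_ord.
rewrite /obs sl.
under eq_bigr do rewrite bel_path mulr_sumr sl.
rewrite -(big_tuple_cons _ (fun q => mobs m H (head s0 q) x.1 * pathw m q l)) /=.
rewrite -(big_tuple_rev _ (fun q => mobs m H (head s0 q) x.1 * pathw m q l)).
rewrite -(big_ffun_codom _ (fun q =>
   mobs m H (head s0 (rev q)) x.1 * pathw m (rev q) l)) /=.
apply: eq_bigr => s _.
have sE (i : 'I_H.+1) : s i = nth s0 (codom s) i by rewrite nth_codom_ord.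
have sc : size (codom s) = H.+1 by exact: size_codom_ord.
have hd : head s0 (rev (codom s)) = s ord_max.
  by rewrite -nth0 nth_rev sc // subn1 sE.
rewrite hd -[l in pathw _ _ l]revK pathw_rev ?size_rev ?sl //.
rewrite (big_pred1 ord0) //.
(* The last emission is split off since the path weight stops before it, and the last transition
   factor is 1 because that step has no successor. *)
rewrite big_ord_recr /= [X in _ * _ * X]big_ord_recr /=.
rewrite insubF ?ltnn // mulr1 big_split /=.
have -> : nth s0 (codom s) 0 = s ord0 by rewrite sE.
have -> : Zo (inord H) (s ord_max) x.1 = Zo ord_max (s ord_max) (tau ord_max).1.
  rewrite tauE /= nth_rcons size_rev sl ltnn eqxx /=.
  by congr (Zo _ _ _); apply: val_inj; rewrite /= inordK.
set p1 := \prod_(i < H) Zo (widen_ord _ _) _ _.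
set p2 := \prod_(i < H) (match _ with _ => _ end).
set p3 := \prod_(i < H) Tr (inord _) _ _ _; set p4 := \prod_(i < H) Zo (inord _) _ _.
have -> : p4 = p1.
  apply: eq_bigr => i _; rewrite /m /=.
  have -> : inord i = widen_ord (leqnSn H) i by apply: val_inj; rewrite /= inordK // ltnS ltnW.
  by rewrite sE tauE /= nth_rcons size_rev sl ltn_ord.
have -> : p3 = p2.
  apply: eq_bigr => i _; rewrite /m /=.
  have -> : inord i = widen_ord (leqnSn H) i by apply: val_inj; rewrite /= inordK // ltnS ltnW.
  have iH : (i.+1 < H.+1)%N by rewrite ltnS.
  rewrite (insubT (fun k => (k < H.+1)%N) iH) /=.
  by rewrite !sE tauE /= nth_rcons size_rev sl ltn_ord.
by ring.
Qed.

Lemma rtraj_cons tau : exists x l, rtraj tau = x :: l.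
Proof.
have := size_codom_ord tau; rewrite -size_rev -/(rtraj tau).
by case: (rtraj tau) => // x l _; exists x, l.
Qed.

Section Kernels.
Variables (b1 : S -> R) (Tr : 'I_H.+1 -> S -> A -> S -> R)
  (Zo : 'I_H.+1 -> S -> O -> R).

Definition kernels :=
  [/\ forall s, 0 <= b1 s, \sum_s b1 s = 1,
      forall h s a s', 0 <= Tr h s a s' /\ \sum_s2 Tr h s a s2 = 1 &
      forall h s o, 0 <= Zo h s o /\ \sum_o2 Zo h s o2 = 1].

Hypothesis stk : kernels.
Local Notation m := (to_model b1 Tr Zo).

Lemma stochastic_to_model : stochastic m.
Proof. by have [h1 h2 h3 h4] := stk; split => // n; [exact: h3|exact: h4]. Qed.

Lemma traj_probE p (tau : traj) : traj_prob b1 Tr Zo p tau =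
  polw R (pol_act p) (rtraj tau) * lik m (rtraj tau).
Proof.
have [x [l xl]] := rtraj_cons tau.
rewrite /traj_prob pol_probE (env_probE _ _ _ xl) xl lik_cons //.
exact: stochastic_to_model.
Qed.

Lemma sum_traj_prob p : \sum_(tau : traj) traj_prob b1 Tr Zo p tau = 1.
Proof.
have exO : exists o : O, True by exists x0.1.
under eq_bigr do rewrite traj_probE.
rewrite (sum_rtraj (fun l => polw R (pol_act p) l * lik m l)).
exact: (psum_lik stochastic_to_model exO (pol_act p)).
Qed.

Lemma traj_prob_ge0 p (tau : traj) : 0 <= traj_prob b1 Tr Zo p tau.
Proof.
rewrite traj_probE mulr_ge0 ?polw_ge0 ?lik_ge0 //; exact: stochastic_to_model.
Qed.

End Kernels.

Lemma polw01 g (l : seq (O * A)) : polw R g l = 0 \/ polw R g l = 1.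
Proof.
elim: l => [|x l IH] /=; first by right.
case: eqP => _; rewrite ?mul0r; [|by left].
by rewrite mul1r.
Qed.

Lemma hel2_traj_prob b1 Tr Zo b1' Tr' Zo' p : kernels b1 Tr Zo -> kernels b1' Tr' Zo' ->
  hel2 (traj_prob b1 Tr Zo p) (traj_prob b1' Tr' Zo' p) =
  hel (to_model b1 Tr Zo) (to_model b1' Tr' Zo') (pol_act p) H.+1.
Proof.
move=> k k'; rewrite /hel2 /hel /psum.
under eq_bigr do rewrite !traj_probE //.
rewrite (sum_rtraj (fun l => (Num.sqrt (polw R (pol_act p) l * lik (to_model b1 Tr Zo) l) -
   Num.sqrt (polw R (pol_act p) l * lik (to_model b1' Tr' Zo') l)) ^+ 2)).
apply: eq_bigr => l _; have [->|->] := polw01 (pol_act p) l.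
  by rewrite !mul0r subrr expr0n.
by rewrite !mul1r.
Qed.

Variable r : 'I_H.+1 -> O -> A -> R.
Hypothesis r01 : forall h o a, 0 <= r h o a <= 1.

Lemma reward_bounds (tau : traj) :
  0 <= \sum_h r h (tau h).1 (tau h).2 <= H.+1%:R.
Proof.
apply/andP; split; first by apply: sumr_ge0 => h _; case/andP: (r01 h (tau h).1 (tau h).2).
rewrite -[X in X%:R](card_ord H.+1) -sumr_const.
by apply: ler_sum => h _; case/andP: (r01 h (tau h).1 (tau h).2).
Qed.

Lemma value_ge0 b1 Tr Zo p : kernels b1 Tr Zo -> 0 <= value r b1 Tr Zo p.
Proof.
move=> k; apply: sumr_ge0 => tau _; rewrite mulr_ge0 ?traj_prob_ge0 //.
by case/andP: (reward_bounds tau).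
Qed.

Lemma value_diff_le b1 Tr Zo b1' Tr' Zo' p :
  kernels b1 Tr Zo -> kernels b1' Tr' Zo' ->
  value r b1 Tr Zo p - value r b1' Tr' Zo' p <=
  H.+1%:R * psum (pol_act p) H (fun l => \sum_o
     `|obs (to_model b1 Tr Zo) l o - obs (to_model b1' Tr' Zo') l o|).
Proof.
move=> k k'; set m := to_model b1 Tr Zo; set m' := to_model b1' Tr' Zo'.
have -> : psum (pol_act p) H (fun l => \sum_o `|obs m l o - obs m' l o|) =
  psum (pol_act p) H.+1 (fun l => `|lik m l - lik m' l|).
  rewrite psumS; apply: eq_psum => l _; apply: eq_bigr => o _.
  by rewrite !lik_cons //; exact: stochastic_to_model.
rewrite /value -sumrB /psum.
rewrite -(sum_rtraj (fun l => polw R (pol_act p) l * `|lik m l - lik m' l|)).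
rewrite mulr_sumr; apply: ler_sum => tau _.
rewrite -mulrBl !traj_probE // -mulrBr mulrC.
have /andP[r0 r1] := reward_bounds tau.
apply: le_trans (ler_norm _) _; rewrite normrM ger0_norm //.
by rewrite normrM (ger0_norm (polw_ge0 _ _ _)) ler_wpM2r // mulr_ge0 // polw_ge0.
Qed.

Variable alpha : R.
Hypothesis alpha0 : 0 < alpha.

Definition revealing (Zo : 'I_H.+1 -> S -> O -> R) :=
  forall h, alpha <= sigma_min (obs_matrix Zo h).

Lemma revealing_left_inv b1 Tr Zo : revealing Zo ->
  exists2 W, left_inv (to_model b1 Tr Zo) W &
    l1_bound W (Num.sqrt #|S|%:R / alpha).
Proof.
have S0 : (0 < #|S|)%N by apply/card_gt0P; exists s0.
move=> rv; have /choice [W hW] : forall n : nat, exists W : S -> O -> R,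
   (forall s s', \sum_o W s o * Zo (inord n) s' o = (s == s')%:R) /\
   (forall v : O -> R, \sum_s `|\sum_o W s o * v o| <=
     Num.sqrt #|S|%:R / alpha * \sum_o `|v o|).
  by move=> n; have [W h1 h2] := left_inverse_l1 alpha0 S0 (rv (inord n)); exists W.
exists W => [n s s'|n v]; have [h1 h2] := hW n; first exact: h1.
exact: h2.
Qed.

(** The emission law of [s0] has l1 norm 1 and is decoded into a vector with entry 1 at [s0]. *)
Lemma kappa_ge1 b1 Tr Zo : kernels b1 Tr Zo -> revealing Zo ->
  1 <= Num.sqrt #|S|%:R / alpha.
Proof.
move=> [_ _ _ k] rv; have [W Wl Wb] := revealing_left_inv b1 Tr rv.
have := Wb 0%N (Zo (inord 0) s0).
have -> : \sum_o `|Zo (inord 0) s0 o| = 1.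
  have [_ <-] := k (inord 0) s0 x0.1; apply: eq_bigr => o _.
  by rewrite ger0_norm //; have [] := k (inord 0) s0 o.
rewrite mulr1; apply: le_trans.
rewrite (bigD1 s0) //= (Wl 0%N s0 s0) eqxx normr1 lerDl; exact: sumr_ge0.
Qed.

Lemma value_decouple b1' Tr' Zo' (q : policy -> R) lambda :
  kernels b1' Tr' Zo' -> revealing Zo' ->
  (forall p, 0 <= q p) -> \sum_p q p = 1 -> 0 < lambda ->
  let kappa := Num.sqrt #|S|%:R / alpha in
  exists Gamma : policy -> R,
    \sum_p q p * Gamma p <=
      H.+1%:R * (#|O|%:R ^+ 2 * #|A|%:R * #|S|%:R) / (2 * lambda) /\
    forall b1 Tr Zo, kernels b1 Tr Zo -> revealing Zo -> forall p,
      value r b1 Tr Zo p - value r b1' Tr' Zo' p <=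
      H.+1%:R * (kappa * (Gamma p + 32 * H.+1%:R * kappa ^+ 2 * lambda *
        \sum_p' q p' * hel2 (traj_prob b1 Tr Zo p') (traj_prob b1' Tr' Zo' p'))).
Proof.
move=> k' rv' q0 q1 lam0 kappa.
have exO : exists o : O, True by exists x0.1.
have A0 : (0 < #|A|)%N by apply/card_gt0P; exists x0.2.
have S0 : (0 < #|S|)%N by apply/card_gt0P; exists s0.
have k1 : 1 <= kappa by exact: kappa_ge1 k' rv'.
have [G [G1 G2]] := decouple exO pol_act q0 q1 (stochastic_to_model k') k1 H lam0 A0 S0.
exists G; split => // b1 Tr Zo k rv p.
have [W Wl Wb] := revealing_left_inv b1 Tr rv.
apply: le_trans (value_diff_le p k k') _; rewrite ler_wpM2l //.
apply: le_trans (G2 _ W (stochastic_to_model k) Wl Wb p) _.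
by under [X in _ <= _ * (_ + _ * X)]eq_bigr do rewrite hel2_traj_prob //.
Qed.

End Bridge.

(** * Expectations of bounded measurable functions *)

Lemma ln_le_sub1 (R : realType) (u : R) : 0 < u -> ln u <= u - 1.
Proof.
move=> u0; have := @le_ln1Dx R (u - 1).
have -> : 1 + (u - 1) = u by ring.
by apply; rewrite ltrBrDr addNr.
Qed.

Section BoundedMeasurable.
Context d (T : measurableType d) (R : realType).
Implicit Types f g : T -> R.

Definition bm f := measurable_fun setT f /\ exists M, forall x, `|f x| <= M.

Lemma bm_cst c : bm (fun=> c).
Proof. by split; [exact: measurable_cst|exists `|c|]. Qed.

Lemma bmD f g : bm f -> bm g -> bm (fun x => f x + g x).
Proof.
move=> [mf [M fM]] [mg [N gN]]; split; first exact: measurable_funD.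
by exists (M + N) => x; apply: le_trans (ler_normD _ _) _; exact: lerD.
Qed.

Lemma bmM f g : bm f -> bm g -> bm (fun x => f x * g x).
Proof.
move=> [mf [M fM]] [mg [N gN]]; split; first exact: measurable_funM.
by exists (M * N) => x; rewrite normrM; exact: ler_pM.
Qed.

Lemma bmZ c f : bm f -> bm (fun x => c * f x).
Proof. exact: bmM (bm_cst c). Qed.

Lemma bmB f g : bm f -> bm g -> bm (fun x => f x - g x).
Proof.
move=> bf bg; have -> : (fun x => f x - g x) = (fun x => f x + -1 * g x).
  by apply/funext => x; rewrite mulN1r.
exact: bmD bf (bmZ _ bg).
Qed.

Lemma bm_sum I (s : seq I) (F : I -> T -> R) : (forall i, bm (F i)) ->
  bm (fun x => \sum_(i <- s) F i x).
Proof.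
move=> bF; elim: s => [|i s IH].
  by under eq_fun do rewrite big_nil; exact: bm_cst.
by under eq_fun do rewrite big_cons; exact: bmD.
Qed.

Lemma bm_prod I (s : seq I) (F : I -> T -> R) : (forall i, bm (F i)) ->
  bm (fun x => \prod_(i <- s) F i x).
Proof.
move=> bF; elim: s => [|i s IH].
  by under eq_fun do rewrite big_nil; exact: bm_cst.
by under eq_fun do rewrite big_cons; exact: bmM.
Qed.

Lemma bm_sqrt f : bm f -> bm (fun x => Num.sqrt (f x)).
Proof.
move=> [mf [M fM]]; split.
  by apply: measurableT_comp mf; apply: continuous_measurable_fun; exact: sqrt_continuous.
exists (Num.sqrt M) => x; rewrite ger0_norm ?sqrtr_ge0 //.
by rewrite ler_wsqrtr // (le_trans (ler_norm _)).
Qed.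

Lemma xlnx_ge (x : R) : 0 <= x -> x - 1 <= x * ln x.
Proof.
rewrite le_eqVlt => /orP [/eqP <-|x0]; first by rewrite mul0r; lra.
have h : ln x^-1 <= x^-1 - 1 by rewrite ln_le_sub1 // invr_gt0.
have := ler_wpM2l (ltW x0) h; rewrite lnV ?posrE //.
rewrite mulrN mulrBr mulfV ?gt_eqF // mulr1; lra.
Qed.

Lemma xlnx_le0 (x : R) : 0 <= x <= 1 -> x * ln x <= 0.
Proof. by move=> /andP[x0 x1]; rewrite mulr_ge0_le0 // ln_le0. Qed.

Lemma bm_xlnx f : bm f -> (forall x, 0 <= f x <= 1) ->
  bm (fun x => f x * ln (f x)).
Proof.
move=> [mf _] f01; split.
  by apply: measurable_funM => //; apply: measurableT_comp mf; exact: measurable_ln.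
exists 1 => x; rewrite ler0_norm ?xlnx_le0 //.
have /andP[f0 f1] := f01 x; have := xlnx_ge f0; lra.
Qed.

Variable P : probability T R.

Lemma bm_integrable f : bm f -> P.-integrable setT (EFin \o f).
Proof.
move=> [mf [M fM]]; apply: measurable_bounded_integrable => //.
  exact: (le_lt_trans (probability_le1 P measurableT) (ltry _)).
by exists M; split; [exact: num_real|move=> N MN x _ /=; exact: le_trans (fM x) (ltW MN)].
Qed.

(** Abstracts the properties shared by integration against the prior and its reweighting by a
    likelihood, so that the posterior is never built as a measure. *)
Definition expectation (E : (T -> R) -> R) :=
  [/\ forall c, E (fun=> c) = c,
      forall f g, bm f -> bm g -> E (fun x => f x + g x) = E f + E g,
      forall c f, bm f -> E (fun x => c * f x) = c * E f &
      forall f g, bm f -> bm g -> (forall x, f x <= g x) -> E f <= E g].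

Lemma expectation_Rintegral : expectation (fun f => Rintegral P setT f).
Proof.
split => [c|f g bf bg|c f bf|f g bf bg fg].
- have h : fine (P setT) = 1 by rewrite probability_setT.
  by transitivity (c * fine (P setT)); [exact: Rintegral_cst|rewrite h mulr1].
- by rewrite RintegralD //; exact: bm_integrable.
- by rewrite RintegralZl //; exact: bm_integrable.
- by apply: le_Rintegral => //; exact: bm_integrable.
Qed.

Lemma expectation_density E w : expectation E -> bm w -> (forall x, 0 <= w x) ->
  E w != 0 -> expectation (fun f => E (fun x => w x * f x) / E w).
Proof.
move=> [Ec ED EZ Ele] bw w0 Ew.
have Ew0 : 0 <= E w by rewrite -(Ec 0); exact: Ele (bm_cst 0) bw w0.
split => [c|f g bf bg|c f bf|f g bf bg fg].
- under eq_fun do rewrite mulrC.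
  by rewrite EZ // mulfK.
- under eq_fun do rewrite mulrDr.
  by rewrite ED ?mulrDl //; exact: bmM.
- under eq_fun do rewrite mulrCA.
  by rewrite EZ ?mulrA //; exact: bmM.
- rewrite ler_wpM2r ?invr_ge0 //; apply: Ele; [exact: bmM|exact: bmM|].
  by move=> x; exact: ler_wpM2l.
Qed.

Section ExpectationTheory.
Variables (E : (T -> R) -> R).
Hypothesis expE : expectation E.

Lemma expB f g : bm f -> bm g -> E (fun x => f x - g x) = E f - E g.
Proof.
have [_ ED EZ _] := expE => bf bg.
have -> : (fun x => f x - g x) = (fun x => f x + -1 * g x).
  by apply/funext => x; rewrite mulN1r.
by rewrite ED ?EZ ?mulN1r //; exact: bmZ.
Qed.

Lemma exp_sum I (s : seq I) (F : I -> T -> R) : (forall i, bm (F i)) ->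
  E (fun x => \sum_(i <- s) F i x) = \sum_(i <- s) E (F i).
Proof.
have [Ec ED EZ _] := expE => bF; elim: s => [|i s IH].
  by under eq_fun do rewrite big_nil; rewrite Ec big_nil.
under eq_fun do rewrite big_cons.
by rewrite ED ?IH ?big_cons //; exact: bm_sum.
Qed.

Lemma exp_ge0 f : bm f -> (forall x, 0 <= f x) -> 0 <= E f.
Proof. by have [Ec _ _ Ele] := expE; rewrite -{2}(Ec 0) => bf f0; exact: Ele (bm_cst 0) bf f0. Qed.

Lemma exp_le_cst f c : bm f -> (forall x, f x <= c) -> E f <= c.
Proof. by have [Ec _ _ Ele] := expE; rewrite -{2}(Ec c) => bf fc; exact: Ele bf (bm_cst c) fc. Qed.

End ExpectationTheory.
End BoundedMeasurable.

(** * Mutual information and Hellinger distance *)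

Section HellingerInformation.
Variable R : realType.

(** Apply [ln z <= z - 1] at [z = sqrt y / sqrt x] and multiply by [2 * x]. The term [x - y] is kept
    because it has mean zero when [y] is the mean of [x]. *)
Lemma kl_ge_hellinger (x y : R) : 0 <= x -> 0 < y ->
  (Num.sqrt x - Num.sqrt y) ^+ 2 + x - y <= x * ln x - x * ln y.
Proof.
rewrite le_eqVlt => /orP [/eqP <-|x0] y0.
  by rewrite !mul0r sqrtr0 sub0r sqrrN (sqr_sqrtr (ltW y0)); lra.
have key (u v : R) : 0 < u -> 0 < v ->
    (u - v) ^+ 2 + u ^+ 2 - v ^+ 2 <= u ^+ 2 * ln (u ^+ 2) - u ^+ 2 * ln (v ^+ 2).
  move=> u0 v0; rewrite !lnXn // -[ln u *+ 2]mulr_natl -[ln v *+ 2]mulr_natl.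
  have := ln_le_sub1 (divr_gt0 v0 u0).
  rewrite lnM ?posrE ?invr_gt0 // lnV ?posrE // => h.
  have := ler_wpM2l (mulr_ge0 (ltW u0) (ltW u0)) h.
  have -> : u * u * (v / u - 1) = u * v - u * u by field; rewrite gt_eqF.
  by move: (ln u) (ln v) => a b; nra.
have := key (Num.sqrt x) (Num.sqrt y).
by rewrite !sqrtr_gt0 (sqr_sqrtr (ltW x0)) (sqr_sqrtr (ltW y0)); apply.
Qed.

End HellingerInformation.

Section ExpectedInformation.
Context d (T : measurableType d) (R : realType).
Variable E : (T -> R) -> R.
Hypothesis expE : expectation E.

(** An abstract [E] does not turn [E f = 0] into [f = 0] almost everywhere. Instead [x * ln x] is
    bounded below by a multiple of [x] minus [e], for every [e > 0]. *)
Lemma exp_xlnx_ge0 (f : T -> R) : bm f -> (forall x, 0 <= f x <= 1) ->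
  E f = 0 -> 0 <= E (fun x => f x * ln (f x)).
Proof.
have [Ec ED EZ Ele] := expE; move=> bf f01 Ef0; apply/ler_addgt0Pr => e e0.
rewrite -lerBlDr sub0r -(Ec (- e)).
(* With [sqrt y = e / 2], [kl_ge_hellinger] gives the lower bound [(ln y + 2) f - e sqrt f]: the two
   terms [y] cancel, and [sqrt f <= 1]. *)
have y0 : 0 < (e / 2) ^+ 2 by rewrite exprn_gt0 // divr_gt0.
apply: (@le_trans _ _ (E (fun x => (ln ((e / 2) ^+ 2) + 2) * f x + - e))).
  rewrite ED ?EZ ?Ef0 ?mulr0 ?add0r ?Ec //; [exact: bmZ|exact: bm_cst].
apply: Ele; [by apply: bmD; [exact: bmZ|exact: bm_cst]|exact: bm_xlnx|] => x.
have /andP[f0 f1] := f01 x.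
have := kl_ge_hellinger f0 y0.
rewrite sqrtr_sqr ger0_norm ?divr_ge0 ?(ltW e0) //.
have s0 := sqrtr_ge0 (f x); have s2 := sqr_sqrtr f0.
have s1 : Num.sqrt (f x) <= 1 by rewrite -[leRHS]sqrtr1 ler_wsqrtr.
move: (ln _) (f x * ln (f x)) => L Z.
have : Num.sqrt (f x) * e <= e by rewrite ler_piMl // ltW.
move: (Num.sqrt (f x)) s0 s2 s1 => u s0 s2 s1; nra.
Qed.

Variables (Y : finType) (pr : T -> Y -> R).
Hypotheses (pr0 : forall x y, 0 <= pr x y) (pr1 : forall x, \sum_y pr x y = 1).
Hypothesis bpr : forall y, bm (pr ^~ y).

Let pr01 y x : 0 <= pr x y <= 1.
Proof.
rewrite pr0 /= -(pr1 x) (bigD1 y) //= lerDl; exact: sumr_ge0.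
Qed.

Definition mixture y := E (pr ^~ y).

Lemma mixture_ge0 y : 0 <= mixture y.
Proof. by apply: (exp_ge0 expE) => // x; exact: pr0. Qed.

Lemma bm_hel2_mixture (q : Y -> R) : bm (fun x => hel2 (pr x) q).
Proof.
apply: bm_sum => y; rewrite /=.
have b : bm (fun x => Num.sqrt (pr x y) - Num.sqrt (q y)).
  by apply: bmB; [apply: bm_sqrt; exact: bpr|exact: bm_cst].
exact: (bmM b b).
Qed.

(* The left-hand side is the mutual information of the parameter and the
   observation. *)
Lemma information_ge_hellinger :
  E (fun x => hel2 (pr x) mixture) <=
  E (fun x => \sum_y pr x y * ln (pr x y)) - \sum_y mixture y * ln (mixture y).
Proof.
have [Ec ED EZ Ele] := expE.
have bx y : bm (fun x => pr x y * ln (pr x y)).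
  by apply: bm_xlnx; [exact: bpr|exact: pr01].
have bh y : bm (fun x => (Num.sqrt (pr x y) - Num.sqrt (mixture y)) ^+ 2).
  have b : bm (fun x => Num.sqrt (pr x y) - Num.sqrt (mixture y)).
    by apply: bmB; [apply: bm_sqrt; exact: bpr|exact: bm_cst].
  exact: (bmM b b).
rewrite /hel2 !(exp_sum expE) // -sumrB; apply: ler_sum => y _.
have := mixture_ge0 y; rewrite le_eqVlt => /orP [/eqP m0|m0]; last first.
  (* Adding [pr x y - mixture y], of expectation 0, gives the form of the pointwise inequality. *)
  have -> : E (fun x => (Num.sqrt (pr x y) - Num.sqrt (mixture y)) ^+ 2) =
     E (fun x => (Num.sqrt (pr x y) - Num.sqrt (mixture y)) ^+ 2 + (pr x y - mixture y)).
    rewrite ED //; last by apply: bmB; [exact: bpr|exact: bm_cst].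
    rewrite (expB expE) //; last exact: bm_cst.
    by rewrite Ec subrr addr0.
  have -> : E (fun x => pr x y * ln (pr x y)) - mixture y * ln (mixture y) =
     E (fun x => pr x y * ln (pr x y) - ln (mixture y) * pr x y).
    rewrite (expB expE) //; last exact: bmZ.
    by rewrite EZ // [ln _ * _]mulrC.
  apply: Ele.
  - by apply: bmD => //; apply: bmB; [exact: bpr|exact: bm_cst].
  - by apply: bmB => //; exact: bmZ.
  - by move=> x; rewrite addrA [ln _ * _]mulrC; exact: kl_ge_hellinger.
rewrite -m0 sqrtr0 mul0r subr0.
have -> : (fun x => (Num.sqrt (pr x y) - 0) ^+ 2) = pr ^~ y.
  by apply/funext => x; rewrite subr0 sqr_sqrtr.
rewrite -/(mixture y) -m0; apply: exp_xlnx_ge0 => //; exact: pr01.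
Qed.

End ExpectedInformation.

(** * Regret and information of posterior sampling *)

Section PosteriorSampling.
Context d (T : measurableType d) (R : realType).
Variable P : probability T R.
Variables (Y Pi : finType).
Variables (pr : T -> Pi -> Y -> R) (val : T -> Pi -> R) (plan : T -> Pi).
Hypotheses (pr0 : forall x p y, 0 <= pr x p y)
  (pr1 : forall x p, \sum_y pr x p y = 1)
  (bpr : forall p y, bm (fun x => pr x p y))
  (bval : forall p, bm (val ^~ p))
  (bplan : forall p, bm (fun x => (plan x == p)%:R : R))
  (plan_opt : forall x p, val x p <= val x (plan x)).

Local Notation I f := (Rintegral P setT f).
Local Notation seqD := (seq (Y * Pi)).
Implicit Types l : seqD.

Let expI := expectation_Rintegral P.

Definition lkl l x : R := \prod_(z <- l) pr x z.2 z.1.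
Definition evidence l := I (lkl l).
Definition post l p := I (fun x => lkl l x * (plan x == p)%:R) / evidence l.
(** Only the probabilities of the algorithm's own draws; the trajectories are weighted by [lkl],
    under a parameter that is integrated later. Data are newest first. *)
Fixpoint alg l : R := if l is z :: l' then post l' z.2 * alg l' else 1.

Lemma lkl_cons z l x : lkl (z :: l) x = pr x z.2 z.1 * lkl l x.
Proof. by rewrite /lkl big_cons. Qed.

Lemma pr01 p y x : 0 <= pr x p y <= 1.
Proof.
rewrite pr0 /= -(pr1 x p) (bigD1 y) //= lerDl; exact: sumr_ge0.
Qed.

Lemma lkl01 l x : 0 <= lkl l x <= 1.
Proof.
elim: l => [|z l IH]; first by rewrite /lkl big_nil ler01 lexx.
have /andP[h0 h1] := IH; have /andP[k0 k1] := pr01 z.2 z.1 x.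
by rewrite lkl_cons mulr_ge0 //= mulr_ile1.
Qed.

Lemma lkl_ge0 l x : 0 <= lkl l x.
Proof. by have /andP[] := lkl01 l x. Qed.

Lemma bm_lkl l : bm (lkl l).
Proof. by apply: bm_prod => z; exact: bpr. Qed.

Lemma evidence_ge0 l : 0 <= evidence l.
Proof. apply: (exp_ge0 expI); [exact: bm_lkl|exact: lkl_ge0]. Qed.

Lemma post_ge0 l p : 0 <= post l p.
Proof.
rewrite divr_ge0 ?evidence_ge0 //; apply: (exp_ge0 expI) => [|x].
  exact: bmM (bm_lkl l) (bplan p).
by rewrite mulr_ge0 ?lkl_ge0.
Qed.

Lemma sum_plan (F : Pi -> R) x : \sum_p (plan x == p)%:R * F p = F (plan x).
Proof.
rewrite (bigD1 (plan x)) //= eqxx mul1r big1 ?addr0 // => p pp.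
by rewrite eq_sym (negbTE pp) mul0r.
Qed.

Lemma sum_post l : evidence l != 0 -> \sum_p post l p = 1.
Proof.
move=> m0; rewrite -mulr_suml -(exp_sum expI) => [|p]; last first.
  exact: bmM (bm_lkl l) (bplan p).
rewrite (_ : (fun x => _) = lkl l) ?mulfV //; apply/funext => x.
rewrite -mulr_sumr; have := sum_plan (fun=> 1) x.
by under eq_bigr do rewrite mulr1; move=> ->; rewrite mulr1.
Qed.

Lemma post_evidence0 l p : evidence l = 0 -> post l p = 0.
Proof. by move=> m0; rewrite /post m0 invr0 mulr0. Qed.

(** On data of evidence 0 the quotient [post] is 0, so the draws lose their mass there; the
    inequality suffices for nonnegative summands. *)
Lemma sum_post_le1 l : \sum_p post l p <= 1.
Proof.
have [m0|m0] := eqVneq (evidence l) 0; last by rewrite sum_post.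
by rewrite big1 // => p _; exact: post_evidence0.
Qed.

Lemma alg_ge0 l : 0 <= alg l.
Proof. by elim: l => //= z l IH; rewrite mulr_ge0 ?post_ge0. Qed.

Definition dsum n (F : seqD -> R) := \sum_(t : n.-tuple (Y * Pi)) alg t * F t.

Lemma dsumS n F : dsum n.+1 F =
  dsum n (fun l => \sum_p post l p * \sum_y F ((y, p) :: l)).
Proof.
rewrite /dsum (big_tuple_cons _ (fun l => alg l * F l)) exchange_big /=.
apply: eq_bigr => l _; rewrite mulr_sumr.
transitivity (\sum_y \sum_p post l p * alg l * F ((y, p) :: l)).
  by rewrite pair_big; apply: eq_bigr => -[].
rewrite exchange_big /=; apply: eq_bigr => p _.
by rewrite !mulr_sumr; apply: eq_bigr => y _; ring.
Qed.

Lemma dsum0 F : dsum 0 F = F [::].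
Proof. by rewrite /dsum (big_tuple_nil (fun l => alg l * F l)) /= mul1r. Qed.

Lemma ler_dsum n F G : (forall l, F l <= G l) -> dsum n F <= dsum n G.
Proof. by move=> FG; apply: ler_sum => l _; rewrite ler_wpM2l ?alg_ge0. Qed.

Lemma dsumD n F G : dsum n (fun l => F l + G l) = dsum n F + dsum n G.
Proof. by rewrite /dsum -big_split; apply: eq_bigr => l _; rewrite /= mulrDr. Qed.

Lemma dsumZ n c F : dsum n (fun l => c * F l) = c * dsum n F.
Proof. by rewrite /dsum mulr_sumr; apply: eq_bigr => l _; rewrite mulrCA. Qed.

Lemma sum_pr_lkl l p (f : T -> R) : bm f ->
  \sum_y I (fun x => lkl ((y, p) :: l) x * f x) = I (fun x => lkl l x * f x).
Proof.
move=> bf; rewrite -(exp_sum expI) => [|y]; last exact: bmM (bm_lkl _) bf.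
congr (Rintegral _ _ _); apply/funext => x.
under eq_bigr do rewrite lkl_cons -mulrA.
by rewrite -mulr_suml pr1 mul1r.
Qed.

Lemma sum_evidence l p : \sum_y evidence ((y, p) :: l) = evidence l.
Proof.
have h l' : evidence l' = I (fun x => lkl l' x * 1).
  by congr (Rintegral _ _ _); apply/funext => x; rewrite mulr1.
by under eq_bigr do rewrite h; rewrite sum_pr_lkl -?h //; exact: bm_cst.
Qed.

Lemma dsum_evidence n : dsum n evidence <= 1.
Proof.
have [Ec _ _ _] := expI.
elim: n => [|n IH].
  rewrite dsum0 /evidence (_ : lkl [::] = fun=> 1) ?Ec //.
  by apply/funext => x; rewrite /lkl big_nil.
rewrite dsumS; apply: le_trans IH; apply: ler_dsum => l.
under eq_bigr do rewrite sum_evidence.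
by rewrite -mulr_suml ler_piMl ?evidence_ge0 ?sum_post_le1.
Qed.

Definition predictive l p y := evidence ((y, p) :: l) / evidence l.

Definition info l p := I (fun x => lkl l x * hel2 (pr x p) (predictive l p)).

(** The evidence times the relative entropy, with respect to the prior, of the posterior, whose
    density is [lkl l / evidence l]. Its [dsum] is the mutual information of the parameter and the
    data. *)
Definition entropy l := I (fun x => lkl l x * ln (lkl l x)) - evidence l * ln (evidence l).

Definition postE l (f : T -> R) := I (fun x => lkl l x * f x) / evidence l.

Lemma expectation_postE l : evidence l != 0 -> expectation (postE l).
Proof.
by move=> m0; apply: expectation_density => //; [exact: bm_lkl|exact: lkl_ge0].
Qed.

Lemma predictiveE l p : predictive l p = mixture (postE l) (fun x => pr x p).
Proof.
apply/funext => y; rewrite /predictive /mixture /postE; congr (_ / _).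
by congr (Rintegral _ _ _); apply/funext => x; rewrite lkl_cons mulrC.
Qed.

Lemma bm_hel2 p (q : Y -> R) : bm (fun x => hel2 (pr x p) q).
Proof. apply: (@bm_hel2_mixture _ _ _ _ (fun x => pr x p)) => y; exact: bpr. Qed.

Lemma lkl_xlnx l : bm (fun x => lkl l x * ln (lkl l x)).
Proof. by apply: bm_xlnx; [exact: bm_lkl|exact: lkl01]. Qed.

Lemma entropy_le0 l : evidence l = 0 -> entropy l <= 0.
Proof.
move=> m0; rewrite /entropy m0 mul0r subr0.
apply: (exp_le_cst expI); first exact: lkl_xlnx.
by move=> x; apply: xlnx_le0; exact: lkl01.
Qed.

Lemma ln_mul0 (a b : R) : 0 <= a -> 0 <= b ->
  a * b * ln (a * b) = b * (a * ln a) + a * (b * ln b).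
Proof.
rewrite le_eqVlt => /orP [/eqP <-|a0]; first by rewrite !mul0r mulr0 addr0.
rewrite le_eqVlt => /orP [/eqP <-|b0]; first by rewrite !mul0r !mulr0 !mul0r addr0.
by rewrite lnM ?posrE //; ring.
Qed.

(** Chain rule: the increment is the evidence times the mutual information, under the posterior, of
    the parameter and the next observation, to which [information_ge_hellinger] applies with
    [postE l]. *)
Lemma entropy_chain l p : evidence l != 0 ->
  entropy l + info l p <= \sum_y entropy ((y, p) :: l).
Proof.
move=> m0; have mp : 0 < evidence l by rewrite lt_neqAle eq_sym m0 evidence_ge0.
have [_ ID IZ _] := expI.
have eE := expectation_postE m0.
have inf := information_ge_hellinger eE (fun x y => pr0 x p y) (fun x => pr1 x p)
   (fun y => bpr p y).
rewrite -predictiveE in inf.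
have pp0 y : 0 <= predictive l p y by rewrite divr_ge0 ?evidence_ge0.
have pp1 : \sum_y predictive l p y = 1.
  by rewrite -mulr_suml sum_evidence mulfV.
have evE y : evidence ((y, p) :: l) = evidence l * predictive l p y.
  by rewrite /predictive mulrC mulfVK.
have bx y : bm (fun x => pr x p y * ln (pr x p y)).
  by apply: bm_xlnx; [exact: bpr|exact: pr01].
have s1 : \sum_y I (fun x => lkl ((y, p) :: l) x * ln (lkl ((y, p) :: l) x)) =
   I (fun x => lkl l x * ln (lkl l x)) +
   I (fun x => lkl l x * \sum_y pr x p y * ln (pr x p y)).
  rewrite -(exp_sum expI) => [|y]; last exact: lkl_xlnx.
  rewrite -ID; last first.
  - by apply: bmM; [exact: bm_lkl|exact: bm_sum].
  - exact: lkl_xlnx.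
  congr (Rintegral _ _ _); apply/funext => x.
  under eq_bigr do rewrite lkl_cons ln_mul0 ?lkl_ge0 //=.
  by rewrite big_split /= -mulr_sumr -mulr_suml pr1 mul1r addrC.
have s2 : \sum_y evidence ((y, p) :: l) * ln (evidence ((y, p) :: l)) =
   evidence l * ln (evidence l) +
   evidence l * \sum_y predictive l p y * ln (predictive l p y).
  under eq_bigr do rewrite evE ln_mul0 ?evidence_ge0 //=.
  by rewrite big_split /= -mulr_sumr -mulr_suml pp1 mul1r.
have := ler_wpM2l (ltW mp) inf.
rewrite mulrBr /postE ![evidence l * (_ / evidence l)]mulrC !mulfVK // => {}inf.
rewrite /entropy sumrB s1 s2 /info; move: inf.
set a := I _; set b := I _; set c := evidence l * _; set e := I _; set f := evidence l * _.
lra.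
Qed.

Variables (a b : R) (lambda : R).
Hypotheses (a0 : 0 <= a) (b0 : 0 <= b) (lam0 : 0 < lambda).
(** [Gamma] may depend on the reference [x0] but not on [x], so it can be averaged over the sampled
    policy while [x0] is held fixed. *)
Hypothesis decoupling : forall x0 (q : Pi -> R),
  (forall p, 0 <= q p) -> \sum_p q p = 1 ->
  exists Gamma : Pi -> R, \sum_p q p * Gamma p <= a / lambda /\
    forall x p, val x p - val x0 p <= Gamma p + b * lambda *
      \sum_p' q p' * hel2 (pr x p') (pr x0 p').

Definition gap x p := val x (plan x) - val x p.

Lemma bm_opt : bm (fun x => val x (plan x)).
Proof.
have -> : (fun x => val x (plan x)) = (fun x => \sum_p (plan x == p)%:R * val x p).
  by apply/funext => x; rewrite sum_plan.
by apply: bm_sum => p; apply: bmM; [exact: bplan|exact: bval].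
Qed.

Lemma bm_gap p : bm (gap ^~ p).
Proof. exact: bmB bm_opt (bval p). Qed.

Lemma gap_ge0 x p : 0 <= gap x p.
Proof. by rewrite subr_ge0 plan_opt. Qed.

(* [E] is the posterior expectation and [q] the law of the sampled policy. The
   decoupling inequality is used at the true parameter, whose posterior law is
   that of the sampled parameter. *)
Lemma gap_le_info l : \sum_p post l p * I (fun x => lkl l x * gap x p) <=
  evidence l * (a / lambda) + 4 * b * lambda * \sum_p post l p * info l p.
Proof.
have [m0|m0] := eqVneq (evidence l) 0.
  rewrite m0 mul0r add0r big1 => [|p _]; last by rewrite post_evidence0 ?mul0r.
  by rewrite big1 ?mulr0 // => p _; rewrite post_evidence0 ?mul0r.
have mp : 0 < evidence l by rewrite lt_neqAle eq_sym m0 evidence_ge0.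
pose E := postE l; pose q := post l.
have eE : expectation E := expectation_postE m0; have [Ec ED EZ Ele] := eE.
have q0 p : 0 <= q p by exact: post_ge0.
have q1 : \sum_p q p = 1 by exact: sum_post.
have IE f : I (fun x => lkl l x * f x) = evidence l * E f.
  by rewrite /E /postE mulrC mulfVK.
pose h p x := hel2 (pr x p) (predictive l p).
have bh p : bm (h p) by exact: bm_hel2.
pose hs x := \sum_p q p * h p x.
have bhs : bm hs by apply: bm_sum => p; exact: bmZ.
have Ehs : E hs = \sum_p q p * E (h p).
  by rewrite /hs (exp_sum eE) => [|p]; [apply: eq_bigr => p _; rewrite EZ|exact: bmZ].
pose vs x0 := \sum_p q p * val x0 p.
have bvs : bm vs by apply: bm_sum => p; exact: bmZ.
(* The true parameter [x0] is held fixed and the sampled one [x] averaged; [plan x] then has law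
   [q]. The triangle inequality through the predictive law separates [x] from [x0]. *)
have ref x0 : E (fun x => val x (plan x)) - vs x0 <=
    a / lambda + 2 * b * lambda * E hs + 2 * b * lambda * hs x0.
  have [G [G1 G2]] := decoupling x0 q0 q1.
  have EP (F : Pi -> R) : E (fun x => F (plan x)) = \sum_p q p * F p.
    have -> : (fun x => F (plan x)) = (fun x => \sum_p F p * (plan x == p)%:R).
      by apply/funext => x; rewrite -(sum_plan F); apply: eq_bigr => p _; rewrite mulrC.
    rewrite (exp_sum eE) => [|p]; last exact: bmZ.
    by apply: eq_bigr => p _; rewrite EZ // mulrC.
  have bP (F : Pi -> R) : bm (fun x => F (plan x)).
    have -> : (fun x => F (plan x)) = (fun x => \sum_p (plan x == p)%:R * F p).
      by apply/funext => x; rewrite sum_plan.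
    by apply: bm_sum => p; apply: bmM; [exact: bplan|exact: bm_cst].
  rewrite /vs -EP -(expB eE) //; last exact: bm_opt.
  apply: (@le_trans _ _ (E (fun x => G (plan x) +
      (2 * b * lambda * hs x + 2 * b * lambda * hs x0)))).
    apply: Ele => [||x].
    - exact: bmB bm_opt (bP _).
    - apply: bmD; first exact: bP.
      by apply: bmD; [exact: (bmZ (2 * b * lambda) bhs)|exact: bm_cst].
    apply: le_trans (G2 x (plan x)) _; rewrite lerD2l.
    rewrite -mulrDr -!mulrA [2 * _]mulrCA; apply: ler_wpM2l => //.
    rewrite mulrCA; apply: ler_wpM2l; first exact: ltW.
    rewrite mulrDr /hs !mulr_sumr -big_split /=; apply: ler_sum => p _.
    rewrite ![2 * (q p * _)]mulrCA -mulrDr; apply: ler_wpM2l => //.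
    exact: hel2_triangle.
  have bhs' : bm (fun x => 2 * b * lambda * hs x) by exact: bmZ.
  rewrite ED //; last by apply: bmD => //; exact: bm_cst.
  rewrite ED ?(EZ (2 * b * lambda) hs) ?Ec //; last exact: bm_cst.
  by rewrite EP addrA lerD2r lerD2r.
(* Now [x0] is averaged too. It has the law of [x], so the two terms in [2 * b * lambda] merge into
   one in [4 * b * lambda]. *)
have main : E (fun x => val x (plan x)) - E vs <= a / lambda + 4 * b * lambda * E hs.
  have := Ele _ _ (bmB (@bm_cst _ T R (E (fun x => val x (plan x)))) bvs)
     (bmD (@bm_cst _ T R (a / lambda + 2 * b * lambda * E hs)) (bmZ (2 * b * lambda) bhs)) ref.
  rewrite (expB eE) ?Ec //; last exact: bm_cst.
  rewrite ED ?(EZ (2 * b * lambda) hs) ?Ec //; [|exact: bm_cst|exact: (bmZ (2 * b * lambda) bhs)].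
  rewrite -/E => h'; apply: le_trans h' _.
  by rewrite le_eqVlt; apply/orP; left; apply/eqP; ring.
have -> : \sum_p post l p * I (fun x => lkl l x * gap x p) =
    evidence l * (E (fun x => val x (plan x)) - E vs).
  have -> : E vs = \sum_p q p * E (val ^~ p).
    by rewrite /vs (exp_sum eE) => [|p]; [apply: eq_bigr => p _; rewrite EZ|exact: bmZ].
  rewrite -[E (fun x => val x (plan x))]mul1r -q1 mulr_suml -sumrB mulr_sumr.
  apply: eq_bigr => p _; rewrite IE mulrCA -mulrBr; congr (_ * (_ * _)).
  by rewrite (expB eE) //; exact: bm_opt.
have -> : \sum_p post l p * info l p = evidence l * E hs.
  rewrite Ehs mulr_sumr; apply: eq_bigr => p _.
  by rewrite /info IE mulrCA.
by rewrite [4 * b * lambda * _]mulrCA -mulrDr; apply: ler_wpM2l; [exact: ltW|exact: main].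
Qed.

Definition cum_gap l x := \sum_(z <- l) gap x z.2.
Definition regret n := dsum n (fun l => I (fun x => lkl l x * cum_gap l x)).
Definition cum_info n := dsum n entropy.

Lemma regret_le_info n :
  regret n <= n%:R * (a / lambda) + 4 * b * lambda * cum_info n.
Proof.
have [Ic ID IZ _] := expI.
have bcum l : bm (cum_gap l) by apply: bm_sum => z; exact: bm_gap.
elim: n => [|n IH].
  have e0 : evidence [::] = 1.
    rewrite /evidence (_ : lkl [::] = fun=> 1) ?Ic //.
    by apply/funext => x; rewrite /lkl big_nil.
  rewrite /regret /cum_info !dsum0 mul0r add0r /entropy e0 ln1 mulr0 subr0.
  rewrite (_ : (fun x => _) = fun=> 0); last first.
    by apply/funext => x; rewrite /cum_gap big_nil mulr0.
  rewrite (_ : (fun x => _) = fun=> 0); last first.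
    by apply/funext => x; rewrite /lkl big_nil ln1 mulr0.
  by rewrite Ic mulr0.
have step1 : regret n.+1 <= regret n +
    dsum n (fun l => \sum_p post l p * I (fun x => lkl l x * gap x p)).
  rewrite /regret dsumS -dsumD; apply: ler_dsum => l.
  have -> : \sum_p post l p *
      \sum_y I (fun x => lkl ((y, p) :: l) x * cum_gap ((y, p) :: l) x) =
    \sum_p post l p * I (fun x => lkl l x * cum_gap l x) +
    \sum_p post l p * I (fun x => lkl l x * gap x p).
    rewrite -big_split /=; apply: eq_bigr => p _; rewrite -mulrDr; congr (_ * _).
    have -> : \sum_y I (fun x => lkl ((y, p) :: l) x * cum_gap ((y, p) :: l) x) =
       \sum_y I (fun x => lkl ((y, p) :: l) x * (cum_gap l x + gap x p)).
      apply: eq_bigr => y _; congr (Rintegral _ _ _); apply/funext => x.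
      by rewrite /cum_gap big_cons addrC.
    rewrite sum_pr_lkl; last by apply: bmD => //; exact: bm_gap.
    rewrite -ID; last first.
    - by apply: bmM; [exact: bm_lkl|exact: bm_gap].
    - by apply: bmM => //; exact: bm_lkl.
    by congr (Rintegral _ _ _); apply/funext => x; rewrite mulrDr.
  rewrite lerD2r -mulr_suml ler_piMl ?sum_post_le1 //.
  apply: (exp_ge0 expI); first by apply: bmM => //; exact: bm_lkl.
  move=> x; rewrite mulr_ge0 ?lkl_ge0 // /cum_gap; apply: sumr_ge0 => z _.
  exact: gap_ge0.
have step2 : dsum n (fun l => \sum_p post l p * I (fun x => lkl l x * gap x p)) <=
    a / lambda + 4 * b * lambda * dsum n (fun l => \sum_p post l p * info l p).
  apply: (@le_trans _ _ (dsum n (fun l => a / lambda * evidence l +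
     4 * b * lambda * \sum_p post l p * info l p))).
    by apply: ler_dsum => l; rewrite [a / _ * _]mulrC; exact: gap_le_info.
  rewrite dsumD !dsumZ lerD2r ler_piMr ?dsum_evidence // divr_ge0 // ltW //.
have step3 : cum_info n + dsum n (fun l => \sum_p post l p * info l p) <= cum_info n.+1.
  rewrite /cum_info dsumS -dsumD; apply: ler_dsum => l.
  have [m0|m0] := eqVneq (evidence l) 0.
    rewrite !big1 ?addr0 ?entropy_le0 // => p _; by rewrite post_evidence0 // mul0r.
  rewrite -[entropy l]mul1r -(sum_post m0) mulr_suml -big_split /=.
  apply: ler_sum => p _; rewrite -mulrDr ler_wpM2l ?post_ge0 //.
  exact: entropy_chain.
have blam : 0 <= 4 * b * lambda by rewrite !mulr_ge0 // ltW.
have := ler_wpM2l blam step3; rewrite mulrDr -natr1 mulrDl mul1r.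
move: step1 step2 IH; lra.
Qed.

Variables (G : finType) (u : G -> Pi -> Y -> R) (omega : R).
Hypotheses (u0 : forall g p y, 0 <= u g p y)
  (u1 : forall g p, \sum_y u g p y <= omega)
  (ucover : forall x, exists g, forall p y, pr x p y <= u g p y).

(** A sum over brackets, not a maximum: it stays a combination of products over episodes, whose
    masses multiply, and it dominates each of them at the price [#|G|]. *)
Definition envelope l := \sum_g \prod_(z <- l) u g z.2 z.1.

Lemma lkl_le_envelope l x : lkl l x <= envelope l.
Proof.
have [g hg] := ucover x.
apply: (@le_trans _ _ (\prod_(z <- l) u g z.2 z.1)).
  by apply: ler_prod => z _; rewrite pr0 hg.
rewrite /envelope (bigD1 g) //= lerDl; apply: sumr_ge0 => g' _.
by apply: prodr_ge0.
Qed.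

Lemma envelope_ge0 l : 0 <= envelope l.
Proof. by apply: sumr_ge0 => g _; apply: prodr_ge0. Qed.

Lemma dsum_envelope n : dsum n envelope <= #|G|%:R * omega ^+ n.
Proof.
rewrite /dsum /envelope; under eq_bigr do rewrite mulr_sumr.
rewrite exchange_big /=.
apply: (@le_trans _ _ (\sum_(g : G) omega ^+ n)); last first.
  by rewrite sumr_const mulr_natl.
apply: ler_sum => g _; pose F l := \prod_(z <- l) u g z.2 z.1.
have F0 l : 0 <= F l by apply: prodr_ge0.
rewrite -/(dsum n F); elim: n => [|n IH]; first by rewrite dsum0 /F big_nil.
rewrite dsumS exprS.
(* A policy is needed to see [0 <= omega]; it comes from a parameter, which exists because [P] has
   mass 1. *)
have [/existsP[p _]|/existsPn noPi] := boolP [exists p : Pi, true]; last first.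
  have [x _] : exists x : T, True.
    apply: contrapT => nT; have [Ic _ _ Ile] := expI.
    have : I (fun=> 1) <= I (fun=> 0).
      by apply: Ile; [exact: bm_cst|exact: bm_cst|move=> x; case: nT; exists x].
    by rewrite !Ic ler10.
  by case/negP: (noPi (plan x)).
have om0 : 0 <= omega by apply: le_trans (u1 g p); exact: sumr_ge0.
apply: le_trans (ler_wpM2l om0 IH); rewrite -dsumZ; apply: ler_dsum => l.
apply: (@le_trans _ _ (\sum_p post l p * (omega * F l))).
  apply: ler_sum => p' _; rewrite ler_wpM2l ?post_ge0 //.
  under eq_bigr do rewrite /F big_cons /=.
  by rewrite -mulr_suml; apply: ler_wpM2r; [exact: F0|exact: u1].
by rewrite -mulr_suml ler_piMl ?sum_post_le1 ?mulr_ge0.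
Qed.

(** Inside the logarithm the likelihood is replaced by the envelope. Jensen is then used in linear
    form: [ln z <= z - 1] at [z = envelope / (c * evidence)] bounds [entropy] by
    [(ln c - 1) * evidence + envelope / c], which sums to at most [(ln c - 1) + 1]. The condition
    [1 <= ln c] makes the first coefficient nonnegative. *)
Lemma cum_info_le n c : 1 <= ln c -> 0 < c -> #|G|%:R * omega ^+ n <= c ->
  cum_info n <= ln c.
Proof.
move=> lc c0 hc.
have [Ic _ IZ Ile] := expI.
have key l : entropy l <= (ln c - 1) * evidence l + c^-1 * envelope l.
  have Q0 : 0 <= c^-1 * envelope l by rewrite mulr_ge0 ?envelope_ge0 // invr_ge0 ltW.
  have [m0|m0] := eqVneq (evidence l) 0.
    by rewrite m0 mulr0 add0r; apply: le_trans (entropy_le0 m0) _.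
  have mp : 0 < evidence l by rewrite lt_neqAle eq_sym m0 evidence_ge0.
  have mQ : evidence l <= envelope l.
    by apply: (exp_le_cst expI); [exact: bm_lkl|exact: lkl_le_envelope].
  have Qp : 0 < envelope l by exact: lt_le_trans mQ.
  have h1 : I (fun x => lkl l x * ln (lkl l x)) <= ln (envelope l) * evidence l.
    rewrite /evidence -IZ; last exact: bm_lkl.
    apply: Ile; [exact: lkl_xlnx|by apply: bmZ; exact: bm_lkl|move=> x].
    rewrite mulrC; have := lkl_ge0 l x; rewrite le_eqVlt => /orP [/eqP <-|L0].
      by rewrite !mulr0.
    by rewrite ler_pM2r // ler_ln ?posrE // lkl_le_envelope.
  have h2 := ln_le_sub1 (divr_gt0 Qp (mulr_gt0 c0 mp)).
  have := ler_wpM2l (ltW mp) h2.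
  rewrite lnM ?posrE ?invr_gt0 ?mulr_gt0 // lnV ?posrE ?mulr_gt0 // lnM ?posrE //.
  have -> : evidence l * (envelope l / (c * evidence l) - 1) =
     c^-1 * envelope l - evidence l by field; rewrite m0 gt_eqF.
  rewrite /entropy; move: h1.
  move: (I _) (ln (envelope l)) (ln (evidence l)) (ln c) (c^-1 * envelope l) (evidence l).
  by move=> v1 v2 v3 v4 v5 v6; nra.
apply: (@le_trans _ _ (dsum n (fun l => (ln c - 1) * evidence l + c^-1 * envelope l))).
  exact: ler_dsum.
rewrite dsumD !dsumZ.
have h1 : (ln c - 1) * dsum n evidence <= (ln c - 1) * 1.
  by rewrite ler_wpM2l ?subr_ge0 ?dsum_evidence.
have h2 : c^-1 * dsum n envelope <= 1.
  by rewrite mulrC ler_pdivrMr // mul1r; exact: le_trans (dsum_envelope n) hc.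
by move: h1 h2; lra.
Qed.

End PosteriorSampling.

(** * Upper brackets from rounded models *)

Section Mass.
Variables (R : realType) (S A O : finType).
Implicit Types m : model R S A O.

(** One factor [w] for the initial law, [n] for the transitions and [n.+1] for the emissions. *)
Lemma psum_obs_le m (w : R) g n : 1 <= w ->
  (forall s, 0 <= minit m s) -> \sum_s minit m s <= w ->
  (forall n s a s', 0 <= mtrans m n s a s') ->
  (forall n s a, \sum_s' mtrans m n s a s' <= w) ->
  (forall n s o, 0 <= mobs m n s o) ->
  (forall n s, \sum_o mobs m n s o <= w) ->
  psum g n (fun l => \sum_o obs m l o) <= w ^+ (2 * n.+1).
Proof.
move=> w1 b0 bw T0 Tw Z0 Zw.
have w0 : 0 <= w by exact: le_trans w1.
have bel0 l s : 0 <= bel m l s.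
  elim: l s => [|x l IH] s //=; apply: sumr_ge0 => s' _.
  by rewrite !mulr_ge0.
have obs_lik l : \sum_o obs m l o <= w * lik m l.
  rewrite /obs exchange_big /lik mulr_sumr /=; apply: ler_sum => s _.
  by rewrite -mulr_suml ler_wpM2r.
have lik_obs l x : lik m (x :: l) <= w * obs m l x.1.
  rewrite /lik /= exchange_big /obs mulr_sumr /=; apply: ler_sum => s _.
  by rewrite -mulr_suml -mulr_suml -mulrA ler_wpM2r // mulr_ge0.
have likn : psum g n (lik m) <= w ^+ (2 * n).+1.
  elim: n => [|n IH]; first by rewrite psum0 expr1.
  rewrite mulnS 2!exprS psumS.
  apply: (@le_trans _ _ (psum g n (fun l => w * (w * lik m l)))).
    apply: ler_psum => l _.
    apply: (@le_trans _ _ (w * \sum_o obs m l o)); last by rewrite ler_wpM2l.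
    by rewrite mulr_sumr; apply: ler_sum => o _; exact: lik_obs.
  by rewrite !psumZ !mulrA ler_wpM2l // mulr_ge0.
rewrite mulnS exprS; apply: le_trans (ler_wpM2l w0 likn).
by rewrite -psumZ; apply: ler_psum => l _; exact: obs_lik.
Qed.

End Mass.

Section Grid.
Variables (R : realType) (S A O : finType) (H N : nat).
Hypothesis N0 : (0 < N)%N.

Definition param := (S + ('I_H.+1 * S * A * S) + ('I_H.+1 * S * O))%type.
Definition grid := {ffun param -> 'I_N.+1}.

(** Index [k] stands for [(k + 1) / N]: taking the integer part of [N v] as index rounds [v] up by
    at most [1 / N], and ['I_N.+1] accommodates [v = 1]. *)
Definition gval (g : grid) i : R := (g i).+1%:R / N%:R.
Definition ginit g s := gval g (inl (inl s)).
Definition gtrans g h s a s' := gval g (inl (inr (h, s, a, s'))).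
Definition gobs g h s o := gval g (inr (h, s, o)).

Definition gvalid (w : R) g := [&& \sum_s ginit g s <= w,
  [forall h, forall s, forall a, \sum_s' gtrans g h s a s' <= w] &
  [forall h, forall s, \sum_o gobs g h s o <= w]].

(** The grid contains tables far from stochastic; they are given the zero law, so that the mass
    bound holds for every index and the brackets can be indexed by the whole grid. *)
Definition gprob (w : R) g (p : policy A O H.+1) (tau : traj A O H.+1) : R :=
  if gvalid w g then traj_prob (ginit g) (gtrans g) (gobs g) p tau else 0.

Lemma gval_ge0 g i : 0 <= gval g i.
Proof. by rewrite divr_ge0. Qed.

Lemma card_grid : #|{: grid}| = (N.+1 ^ #|{: param}|)%N.
Proof. by rewrite card_ffun card_ord. Qed.

Lemma card_param : #|{: param}| =
  (#|S| + H.+1 * #|S| * #|A| * #|S| + H.+1 * #|S| * #|O|)%N.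
Proof. by rewrite !card_sum !card_prod !card_ord. Qed.

Lemma pol_prob_ge0 (p : policy A O H.+1) (tau : traj A O H.+1) : 0 <= pol_prob R p tau.
Proof. by apply: prodr_ge0. Qed.

Lemma env_prob_ge0 (b1 : S -> R) (Tr : 'I_H.+1 -> S -> A -> S -> R)
    (Zo : 'I_H.+1 -> S -> O -> R) (tau : traj A O H.+1) :
  (forall s, 0 <= b1 s) -> (forall h s a s', 0 <= Tr h s a s') ->
  (forall h s o, 0 <= Zo h s o) -> 0 <= env_prob b1 Tr Zo tau .
Proof.
move=> b0 T0 Z0; apply: sumr_ge0 => s _; rewrite !mulr_ge0 //.
- by apply: prodr_ge0.
- by apply: prodr_ge0.
- by apply: prodr_ge0 => h _; case: insub.
Qed.

Lemma env_prob_le (b1 b1' : S -> R) (Tr Tr' : 'I_H.+1 -> S -> A -> S -> R)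
    (Zo Zo' : 'I_H.+1 -> S -> O -> R) (tau : traj A O H.+1) :
  (forall s, 0 <= b1 s <= b1' s) ->
  (forall h s a s', 0 <= Tr h s a s' <= Tr' h s a s') ->
  (forall h s o, 0 <= Zo h s o <= Zo' h s o) ->
  env_prob b1 Tr Zo tau <= env_prob b1' Tr' Zo' tau .
Proof.
move=> hb hT hZ; apply: ler_sum => s _.
have b0 i : 0 <= b1 i by case/andP: (hb i).
have Z0 h i o : 0 <= Zo h i o by case/andP: (hZ h i o).
apply: ler_pM; last 1 first.
- by apply: ler_prod => h _; case: insub => [h'|]; rewrite ?ler01 ?lexx.
- by rewrite mulr_ge0 //; apply: prodr_ge0.
- by apply: prodr_ge0 => h _; case: insub => // h'; case/andP: (hT h (s h) (tau h).2 (s h')).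
apply: ler_pM; [by apply: prodr_ge0|by apply: prodr_ge0| |].
- by apply: ler_prod.
- by apply: ler_prod.
Qed.

Lemma gprob_ge0 w g p tau : 0 <= gprob w g p tau.
Proof.
rewrite /gprob; case: ifP => // _; rewrite mulr_ge0 ?pol_prob_ge0 //.
by apply: env_prob_ge0 => *; exact: gval_ge0.
Qed.

Lemma sum_gprob (s0 : S) (x0 : O * A) w g p : 1 <= w ->
  \sum_tau gprob w g p tau <= w ^+ (2 * H.+1).
Proof.
move=> w1; rewrite /gprob; case: (boolP (gvalid w g)) => [/and3P[hb hT hZ]|_]; last first.
  by rewrite big1 // exprn_ge0 // (le_trans ler01).
pose m := to_model (ginit g) (gtrans g) (gobs g).
pose F (l : seq (O * A)) := if l is x :: l' then obs m l' x.1 else 0.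
have -> : \sum_tau traj_prob (ginit g) (gtrans g) (gobs g) p tau =
    psum (pol_act x0 p) H.+1 F.
  rewrite /psum -(sum_rtraj H (fun l => polw R (pol_act x0 p) l * F l)).
  apply: eq_bigr => tau _; have [x [l xl]] := rtraj_cons tau.
  by rewrite /traj_prob (pol_probE R x0) (env_probE s0 x0 _ _ _ xl) xl.
rewrite psumS; apply: psum_obs_le => //= [s|n s a s'|n s a|n s o|n s].
- exact: gval_ge0.
- exact: gval_ge0.
- by move/forallP/(_ (inord n))/forallP/(_ s)/forallP: hT; exact.
- exact: gval_ge0.
- by move/forallP/(_ (inord n))/forallP: hZ; exact.
Qed.

Lemma grid_cover (x0 : O * A) (b1 : S -> R) (Tr : 'I_H.+1 -> S -> A -> S -> R)
    (Zo : 'I_H.+1 -> S -> O -> R) w : kernels b1 Tr Zo ->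
  1 + #|S|%:R / N%:R <= w -> 1 + #|O|%:R / N%:R <= w ->
  exists g, forall p tau, traj_prob b1 Tr Zo p tau <= gprob w g p tau.
Proof.
move=> [b0 bs T0 Z0] wS wO.
have NR : 0 < N%:R :> R by rewrite ltr0n.
pose v (i : param) : R := match i with
  | inl (inl s) => b1 s
  | inl (inr (h, s, a, s')) => Tr h s a s'
  | inr (h, s, o) => Zo h s o end.
have le1 (I : finType) (f : I -> R) j : (forall i, 0 <= f i) -> \sum_i f i = 1 -> f j <= 1.
  by move=> f0 <-; rewrite (bigD1 j) //= lerDl sumr_ge0.
have v01 i : 0 <= v i <= 1.
  case: i => [[s|[[[h s] a] s']]|[[h s] o]] /=.
  - by rewrite b0 le1.
  - have [-> h1] := T0 h s a s'; apply: (le1 _ (fun s' => Tr h s a s')) => // i.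
    by have [] := T0 h s a i.
  - have [-> h1] := Z0 h s o; apply: (le1 _ (fun o => Zo h s o)) => // i.
    by have [] := Z0 h s i.
pose g : grid := [ffun i => inord (Num.truncn (v i * N%:R))].
have gE i : v i <= gval g i <= v i + N%:R^-1.
  have /andP[v0 v1] := v01 i.
  have vN0 : 0 <= v i * N%:R by rewrite mulr_ge0.
  have /andP[t1 t2] := truncn_itv vN0.
  have tN : (Num.truncn (v i * N%:R) <= N)%N.
    by rewrite -(ler_nat R) (le_trans t1) // ler_piMl.
  rewrite /gval ffunE inordK // ler_pdivlMr // (ltW t2) /=.
  by rewrite ler_pdivrMr // mulrDl mulVf ?gt_eqF // -natr1 lerD2r.
have sumg (I : finType) (f : I -> param) : \sum_i v (f i) = 1 ->
    1 + #|I|%:R / N%:R <= w -> \sum_i gval g (f i) <= w.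
  move=> f1; apply: le_trans.
  apply: (@le_trans _ _ (\sum_i (v (f i) + N%:R^-1))).
    by apply: ler_sum => i _; case/andP: (gE (f i)).
  by rewrite big_split /= f1 sumr_const mulr_natl.
have gv : gvalid w g.
  apply/and3P; split.
  - exact: (sumg _ (fun s => inl (inl s))).
  - apply/forallP => h; apply/forallP => s; apply/forallP => a.
    apply: (sumg _ (fun s' => inl (inr (h, s, a, s')))) => //.
    by have [] := T0 h s a s.
  - apply/forallP => h; apply/forallP => s.
    apply: (sumg _ (fun o => inr (h, s, o))) => //.
    by have [] := Z0 h s x0.1.
exists g => p tau; rewrite /gprob gv ler_wpM2l ?pol_prob_ge0 //.
apply: env_prob_le => [s|h s a s'|h s o].
- by rewrite b0; case/andP: (gE (inl (inl s))).
- by have [-> _] := T0 h s a s'; case/andP: (gE (inl (inr (h, s, a, s')))).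
- by have [-> _] := Z0 h s o; case/andP: (gE (inr (h, s, o))).
Qed.

End Grid.

(** * Bayesian regret bound with a free weight *)

Lemma probability_inhabited d (T : measurableType d) (R : realType)
  (P : probability T R) : exists x : T, True.
Proof.
apply: contrapT => nT; have [Ic _ _ Ile] := expectation_Rintegral P.
have : Rintegral P setT (fun=> 1) <= Rintegral P setT (fun=> 0).
  by apply: Ile; [exact: bm_cst|exact: bm_cst|move=> x; case: nT; exists x].
by rewrite !Ic ler10.
Qed.

Section BayesRegret.
Variables (R : realType) (S A O : finType) (H : nat).
Variables (r : 'I_H.+1 -> O -> A -> R).
Variables (d : measure_display) (T : measurableType d).
Variables (b1 : T -> S -> R) (Tr : T -> 'I_H.+1 -> S -> A -> S -> R)
  (Zo : T -> 'I_H.+1 -> S -> O -> R).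
Variables (P : probability T R) (plan : T -> policy A O H.+1).
Hypothesis r01 : forall h o a, 0 <= r h o a <= 1.
Hypothesis ker : forall th, kernels (b1 th) (Tr th) (Zo th).
Hypotheses (mb : forall s, measurable_fun setT (fun th => b1 th s))
  (mT : forall h s a s', measurable_fun setT (fun th => Tr th h s a s'))
  (mZ : forall h s o, measurable_fun setT (fun th => Zo th h s o)).
Hypothesis mplan : forall p, measurable (plan @^-1` [set p]).
Hypothesis plan_opt : forall th p, value r (b1 th) (Tr th) (Zo th) p
  <= value r (b1 th) (Tr th) (Zo th) (plan th).
Variables (s0 : S) (x0 : O * A).

Let pr th p tau := traj_prob (b1 th) (Tr th) (Zo th) p tau.
Let val th p := value r (b1 th) (Tr th) (Zo th) p.

Lemma opt_valueE th : opt_value r (b1 th) (Tr th) (Zo th) = val th (plan th).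
Proof.
apply/eqP; rewrite eq_le /opt_value; apply/andP; split.
  apply/bigmax_leP; split => [|p _]; last exact: plan_opt.
  exact: (value_ge0 s0 x0 r01 _ (ker th)).
exact: le_bigmax.
Qed.

Lemma bm_kernel_entries :
  [/\ forall s, bm (b1 ^~ s), forall h s a s', bm (fun th => Tr th h s a s') &
      forall h s o, bm (fun th => Zo th h s o)].
Proof.
have le1 (I : finType) (f : I -> R) j : (forall i, 0 <= f i) -> \sum_i f i = 1 -> `|f j| <= 1.
  by move=> f0 <-; rewrite ger0_norm // (bigD1 j) //= lerDl sumr_ge0.
split => [s|h s a s'|h s o]; split => //; exists 1 => th; have [h1 h2 h3 h4] := ker th.
- exact: le1.
- apply: (le1 _ (fun s' => Tr th h s a s')) => [i|]; first by have [] := h3 h s a i.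
  by have [] := h3 h s a s'.
- apply: (le1 _ (fun o => Zo th h s o)) => [i|]; first by have [] := h4 h s i.
  by have [] := h4 h s o.
Qed.

Lemma bm_traj_prob p tau : bm (fun th => pr th p tau).
Proof.
have [hb hT hZ] := bm_kernel_entries.
apply: bmM; first exact: bm_cst.
apply: bm_sum => s; apply: bmM.
  apply: bmM; last by apply: bm_prod => h; exact: hZ.
  have -> : (fun th => \prod_(h < H.+1 | \val h == 0%N) b1 th (s h)) =
            (fun th => b1 th (s ord0)).
    by apply/funext => th; rewrite (big_pred1 ord0).
  exact: hb.
by apply: bm_prod => h; case: insub => [h'|]; [exact: hT|exact: bm_cst].
Qed.

Lemma bm_value p : bm (fun th => val th p).
Proof.
apply: bm_sum => tau; apply: bmM; [exact: bm_traj_prob|exact: bm_cst].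
Qed.

Lemma bm_plan p : bm (fun th => (plan th == p)%:R : R).
Proof.
split; last by exists 1 => th; case: (_ == _); rewrite ?normr1 ?normr0.
have -> : (fun th => (plan th == p)%:R : R) = \1_(plan @^-1` [set p]).
  apply/funext => th; rewrite indicE; congr (_%:R); congr nat_of_bool.
  apply/eqP/idP => [pp|]; first by rewrite inE.
  by rewrite inE.
exact: measurable_indic.
Qed.

Local Notation postP := (post P pr plan).

(** [ps_breg] lists data oldest first and [alg] newest first; the likelihood is a product, so the
    posterior ignores the order. *)
Lemma post_rev l : postP (rev l) = postP l.
Proof.
have e : lkl pr (rev l) = lkl pr l.
  by apply/funext => th; apply: perm_big; rewrite perm_rev.
by apply/funext => p; rewrite /post /evidence e.
Qed.

Lemma alg_rev (z0 : traj A O H.+1 * policy A O H.+1) l :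
  alg P pr plan (rev l) =
  \prod_(i < size l) postP (take i l) (nth z0 l i).2.
Proof.
elim/last_ind: l => [|s x IH]; first by rewrite big_ord0.
rewrite rev_rcons /= IH size_rcons big_ord_recr /= mulrC; congr (_ * _).
  apply: eq_bigr => i _.
  by rewrite nth_rcons ltn_ord -cats1 takel_cat // ltnW.
by rewrite nth_rcons ltnn eqxx -cats1 take_size_cat // post_rev.
Qed.

Lemma post_pol_probE l p : post_pol_prob b1 Tr Zo P plan l p = postP l p.
Proof. by []. Qed.

Lemma ps_bregE K : ps_breg r b1 Tr Zo P plan K = regret P pr val plan K.
Proof.
have [_ _ IZ _] := expectation_Rintegral P.
have pr0 th p tau : 0 <= pr th p tau by exact: (traj_prob_ge0 s0 x0 (ker th)).
pose F th l := alg P pr plan l * (lkl pr l th * cum_gap val plan l th).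
have bF l : bm (F ^~ l).
  apply: bmZ; apply: bmM; first by apply: bm_prod => z; exact: bm_traj_prob.
  apply: bm_sum => z; apply: bmB; last exact: bm_value.
  exact: (bm_opt bm_value bm_plan).
have -> : ps_breg r b1 Tr Zo P plan K =
    Rintegral P setT (fun th => \sum_(t : K.-tuple (traj A O H.+1 * policy A O H.+1)) F th t).
  rewrite /ps_breg; congr (Rintegral _ _ _); apply/funext => th.
  rewrite -(big_tuple_rev _ (F th)) -(big_ffun_codom _ (fun l => F th (rev l))).
  apply: eq_bigr => dat _.
  have tz0 : traj A O H.+1 * policy A O H.+1 by exact: ([ffun=> x0], plan th).
  have h1 : alg P pr plan (rev (codom dat)) =
      \prod_(k < K) post_pol_prob b1 Tr Zo P plan (take k (codom dat)) (dat k).2.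
    rewrite (alg_rev tz0) size_codom_ord; apply: eq_bigr => k _.
    by rewrite nth_codom_ord post_pol_probE.
  have h2 : lkl pr (rev (codom dat)) th =
      \prod_(k < K) traj_prob (b1 th) (Tr th) (Zo th) (dat k).2 (dat k).1.
    by rewrite /lkl (perm_big (codom dat)) ?perm_rev //= codomE big_map big_enum.
  have h3 : cum_gap val plan (rev (codom dat)) th =
      \sum_(k < K) (opt_value r (b1 th) (Tr th) (Zo th) -
        value r (b1 th) (Tr th) (Zo th) (dat k).2).
    rewrite /cum_gap (perm_big (codom dat)) ?perm_rev //= codomE big_map big_enum /=.
    by apply: eq_bigr => k _; rewrite opt_valueE.
  by rewrite /F h1 h2 h3 mulrA big_split.
rewrite (exp_sum (expectation_Rintegral P)) => [|t]; last exact: bF.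
apply: eq_bigr => t _; rewrite IZ //; apply: bmM; first by apply: bm_prod => z; exact: bm_traj_prob.
apply: bm_sum => z; apply: bmB; last exact: bm_value.
exact: (bm_opt bm_value bm_plan).
Qed.

Variable alpha : R.
Hypotheses (alpha0 : 0 < alpha) (leSO : (#|S| <= #|O|)%N) (rv : forall th, revealing alpha (Zo th)).

Lemma ps_breg_le K (lambda : R) : (0 < K)%N -> 0 < lambda ->
  let kappa : R := Num.sqrt #|S|%:R / alpha in
  let h := H.+1%:R : R in
  is_true (ps_breg r b1 Tr Zo P plan K <=
    K%:R * (h * kappa * (h * (#|O|%:R ^+ 2 * #|A|%:R * #|S|%:R)) / 2 / lambda) +
    4 * (32 * h ^+ 2 * kappa ^+ 3) * lambda *
    (2 + (#|S| + H.+1 * #|S| * #|A| * #|S| + H.+1 * #|S| * #|O|)%:R *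
         ln (K * H.+1 * #|O|).+1%:R)).
Proof.
move=> K0 lam0 kappa h.
have S0 : (0 < #|S|)%N by apply/card_gt0P; exists s0.
have O0 : (0 < #|O|)%N by apply/card_gt0P; exists x0.1.
have kap0 : 0 <= kappa by rewrite divr_ge0 ?sqrtr_ge0 // ltW.
have pr0 th p tau : 0 <= pr th p tau by exact: (traj_prob_ge0 s0 x0 (ker th)).
have pr1 th p : \sum_tau pr th p tau = 1 by exact: (sum_traj_prob s0 x0 (ker th)).
rewrite ps_bregE.
set a := h * kappa * _ / 2; set b := 32 * h ^+ 2 * kappa ^+ 3.
have h0 : 0 <= h by exact: ler0n.
have a0 : 0 <= a.
  apply: divr_ge0 => //; apply: mulr_ge0; first exact: mulr_ge0 h0 kap0.
  by rewrite !mulr_ge0 // ?exprn_ge0.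
have b0 : 0 <= b.
  by apply: mulr_ge0; [rewrite mulr_ge0 // exprn_ge0|exact: exprn_ge0].
have dec : forall t0 (q : policy A O H.+1 -> R),
  (forall p, 0 <= q p) -> \sum_p q p = 1 ->
  exists Gamma : policy A O H.+1 -> R, \sum_p q p * Gamma p <= a / lambda /\
    forall t p, val t p - val t0 p <= Gamma p + b * lambda *
      \sum_p' q p' * hel2 (pr t p') (pr t0 p').
  move=> t0 q q0 q1.
  have [G [G1 G2]] := value_decouple s0 x0 r01 alpha0 (ker t0) (rv t0) q0 q1 lam0.
  exists (fun p => h * kappa * G p); split.
    under eq_bigr do rewrite mulrCA.
    rewrite -mulr_sumr.
    apply: le_trans (ler_wpM2l (mulr_ge0 h0 kap0) G1) _.
    rewrite /a -/h; set c := #|O|%:R ^+ 2 * _ * _.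
    by rewrite le_eqVlt; apply/orP; left; apply/eqP; field; rewrite gt_eqF.
  move=> t p; apply: le_trans (G2 _ _ _ (ker t) (rv t) p) _.
  rewrite -/kappa -/h; set E := \sum_p' _.
  by rewrite /b le_eqVlt; apply/orP; left; apply/eqP; ring.
(* The mesh makes [w = 1 + 1 / (K * H.+1)], so that the [2 * H.+1] factors of each of the [K]
   episodes multiply to at most [e^2]: this is the summand 2 in the information. *)
set N := (K * H.+1 * #|O|)%N.
have N0 : (0 < N)%N by rewrite !muln_gt0 K0 O0.
have NR : 0 < N%:R :> R by rewrite ltr0n.
pose w : R := 1 + #|O|%:R / N%:R.
have w1 : 1 <= w by rewrite lerDl divr_ge0.
have cover t : exists g : grid S A O H N,
    forall p tau, pr t p tau <= gprob w g p tau.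
  apply: (grid_cover N0 x0 (ker t)) => //.
  by rewrite lerD2l ler_pM2r ?invr_gt0 // ler_nat.
apply: le_trans (regret_le_info P pr0 pr1 bm_traj_prob bm_value bm_plan plan_opt
  a0 b0 lam0 dec K) _.
rewrite lerD2l; apply: ler_wpM2l.
  by apply: mulr_ge0; [apply: mulr_ge0|exact: ltW].
pose c : R := #|{: grid S A O H N}|%:R * expR 2.
have G0 : 0 < #|{: grid S A O H N}|%:R :> R by rewrite card_grid ltr0n expn_gt0.
have c0 : 0 < c by rewrite mulr_gt0 ?expR_gt0.
have lnc : ln c = 2 + (#|S| + H.+1 * #|S| * #|A| * #|S| + H.+1 * #|S| * #|O|)%:R *
         ln N.+1%:R.
  rewrite /c lnM ?posrE ?expR_gt0 // expRK addrC; congr (_ + _).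
  by rewrite card_grid card_param natrX lnXn // mulr_natl.
rewrite -lnc.
apply: (@cum_info_le _ _ _ P _ _ _ _ pr0 pr1 bm_traj_prob bm_plan _
  (@gprob R S A O H N w) (w ^+ (2 * H.+1))) => //.
- exact: gprob_ge0.
- by move=> g p; exact: (sum_gprob s0 x0 g p w1).
- rewrite lnc; apply: (@le_trans _ _ 2); first by rewrite ler1n.
  by rewrite lerDl mulr_ge0 // ln_ge0 // ler1n.
- rewrite ler_pM2l // -exprM.
  have e : #|O|%:R / N%:R = (K * H.+1)%:R^-1 :> R.
    by rewrite /N [in LHS]natrM invfM mulrCA mulfV ?mulr1 // pnatr_eq0 -lt0n.
  have wexp : w <= expR (K * H.+1)%:R^-1 by rewrite /w e expR_ge1Dx.
  apply: (@le_trans _ _ (expR (K * H.+1)%:R^-1 ^+ (2 * H.+1 * K))).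
    have w0 : 0 <= w by exact: le_trans ler01 w1.
    by apply: lerXn2r; rewrite ?nnegrE ?expR_ge0.
  rewrite -expRM_natl ler_expR -mulnA [(H.+1 * K)%N]mulnC natrM mulfK //.
  by rewrite pnatr_eq0 muln_eq0 negb_or -lt0n K0.
Qed.

End BayesRegret.

(** * Choice of the weight and final rate *)

Lemma balance_step (R : realType) (X Y : R) : 0 < X -> 0 < Y ->
  exists2 lambda, 0 < lambda & X / lambda + Y * lambda = 2 * Num.sqrt (X * Y).
Proof.
move=> X0 Y0; have x0 : 0 < Num.sqrt X by rewrite sqrtr_gt0.
have y0 : 0 < Num.sqrt Y by rewrite sqrtr_gt0.
exists (Num.sqrt X / Num.sqrt Y); first by rewrite divr_gt0.
rewrite sqrtrM ?ltW // -{1}(sqr_sqrtr (ltW X0)) -{2}(sqr_sqrtr (ltW Y0)).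
move: (Num.sqrt X) (Num.sqrt Y) x0 y0 => x y x0 y0.
by field; rewrite !gt_eqF.
Qed.

Lemma ln2_ge_half (R : realType) : 2^-1 <= ln (2 : R).
Proof.
have := @ln_le_sub1 R 2^-1; rewrite invr_gt0 lnV ?posrE // => /(_ (ltr0Sn R 1)).
lra.
Qed.

Lemma regret_rate (R : realType) (s a o h k alpha kappa L J : R) :
  1 <= s -> 1 <= a -> 1 <= o -> 1 <= h -> 0 < k -> 0 < alpha ->
  0 < kappa -> kappa ^+ 4 = s ^+ 2 * alpha ^- 4 -> 2^-1 <= L ->
  J <= 2 + (s + h * s * a * s + h * s * o) * L ->
  exists2 lambda, 0 < lambda &
  k * (h * kappa * (h * (o ^+ 2 * a * s)) / 2 / lambda) +
    4 * (32 * h ^+ 2 * kappa ^+ 3) * lambda * J <=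
  64 * L * (alpha ^- 2 * (h ^+ 2 * Num.sqrt h) * s ^+ 2 * Num.sqrt a *
    (o * Num.sqrt o) * Num.sqrt ((1 + s * a / o) * k)).
Proof.
move=> s1 a1 o1 h1 k0 al0 kap0 kap4 L1 hJ.
have s0 : 0 < s by lra.
have a0 : 0 < a by lra.
have o0 : 0 < o by lra.
have h0 : 0 < h by lra.
have L0 : 0 < L by apply: lt_le_trans L1; rewrite invr_gt0.
have sao0 : 0 < s * a + o by rewrite addr_gt0 // mulr_gt0.
(* The 2 and the lone [s] are absorbed: [2 <= 4 * L], while [s <= h * s * o] and both
   [h * s * (s * a)] and [h * s * o] are at least 1. *)
pose J' := 4 * (h * s * (s * a + o)) * L.
have J'0 : 0 < J' by rewrite !mulr_gt0.
have JJ' : J <= J'.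
  apply: le_trans hJ _; rewrite /J'.
  have hs1 : 1 <= h * s by rewrite mulr_ege1.
  have hso : s <= h * s * o.
    by rewrite -mulrA mulrCA ler_pMr // mulr_ege1.
  have hsa : 0 <= h * s * (s * a) by rewrite !mulr_ge0 // ltW.
  have hsa1 : 1 <= h * s * (s * a) by rewrite !mulr_ege1.
  have hso1 : 1 <= h * s * o by rewrite !mulr_ege1.
  have -> : h * s * a * s = h * s * (s * a) by ring.
  rewrite !mulrDr; move: (h * s * (s * a)) (h * s * o) hsa hsa1 hso1 hso => u v.
  nra.
pose X := k * (h * kappa * (h * (o ^+ 2 * a * s)) / 2).
pose Y := 4 * (32 * h ^+ 2 * kappa ^+ 3) * J'.
have X0 : 0 < X by rewrite /X !mulr_gt0 ?exprn_gt0 // invr_gt0.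
have Y0 : 0 < Y by rewrite /Y !mulr_gt0 ?exprn_gt0.
have [lambda lam0 lamE] := balance_step X0 Y0.
exists lambda => //.
set Tg := alpha ^- 2 * _ * _ * _ * _ * _.
have Tg0 : 0 <= Tg.
  have ia : 0 <= alpha ^- 2 by rewrite invr_ge0 exprn_ge0 // ltW.
  by rewrite /Tg !mulr_ge0 ?sqrtr_ge0 ?exprn_ge0 // ltW.
apply: (@le_trans _ _ (X / lambda + Y * lambda)).
  have -> : k * (h * kappa * (h * (o ^+ 2 * a * s)) / 2 / lambda) = X / lambda.
    by rewrite /X [RHS]mulrAC [RHS]mulrA mulrA; ring.
  rewrite lerD2l /Y [X in _ <= X]mulrAC.
  apply: ler_wpM2l => //; apply: ltW; by rewrite !mulr_gt0 ?exprn_gt0.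
rewrite lamE.
have q0 : 0 <= (1 + s * a / o) * k.
  by rewrite mulr_ge0 ?(ltW k0) // addr_ge0 // divr_ge0 ?mulr_ge0 // ltW.
have Tg2 : Tg ^+ 2 = alpha ^- 4 * h ^+ 5 * s ^+ 4 * a * o ^+ 2 * (o + s * a) * k.
  rewrite /Tg !exprMn !sqr_sqrtr ?(ltW h0) ?(ltW a0) ?(ltW o0) //.
  by field; rewrite !gt_eqF.
have XY : X * Y = 256 * L * Tg ^+ 2.
  transitivity (256 * L * (kappa ^+ 4 * (h ^+ 5 * s ^+ 2 * a * o ^+ 2 * (o + s * a) * k))).
    by rewrite /X /Y /J'; field.
  by rewrite kap4 Tg2; ring.
(* The square root of [256 * L] is below [32 * L] since [L] is at least [1 / 2]; the factor 2 of
   [balance_step] then gives 64. *)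
have : Num.sqrt (X * Y) <= 32 * L * Tg.
  rewrite -[leRHS]ger0_norm; last first.
    by apply: mulr_ge0 => //; rewrite mulr_ge0 // ltW.
  rewrite -sqrtr_sqr ler_sqrt ?sqr_ge0 // XY.
  have -> : (32 * L * Tg) ^+ 2 = 1024 * L ^+ 2 * Tg ^+ 2 by ring.
  by rewrite ler_wpM2r ?sqr_ge0 //; nra.
by move: (Num.sqrt _) => u; move: (Tg) => t; nra.
Qed.

Theorem theorem3 :
  exists (C c : nat),
  forall (R : realType) (S A O : finType) (H K : nat)
    (r : 'I_H -> O -> A -> R)
    (d : measure_display) (T : measurableType d)
    (b1 : T -> S -> R) (Tr : T -> 'I_H -> S -> A -> S -> R)
    (Zo : T -> 'I_H -> S -> O -> R)
    (P : probability T R) (plan : T -> policy A O H) (alpha : R),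
    (* rewards in [0,1] *)
    (forall h o a, 0 <= r h o a <= 1) ->
    (* (b1, T, Z) are probability kernels for every parameter *)
    (forall th s, 0 <= b1 th s) -> (forall th, \sum_(s : S) b1 th s = 1) ->
    (forall th h s a s', 0 <= Tr th h s a s') ->
    (forall th h s a, \sum_(s' : S) Tr th h s a s' = 1) ->
    (forall th h s o, 0 <= Zo th h s o) ->
    (forall th h s, \sum_(o : O) Zo th h s o = 1) ->
    (* measurable parameterization *)
    (forall s, measurable_fun setT (fun th => b1 th s)) ->
    (forall h s a s', measurable_fun setT (fun th => Tr th h s a s')) ->
    (forall h s o, measurable_fun setT (fun th => Zo th h s o)) ->
    (* exact planner: a measurable selection of an optimal policy *)
    (forall p, measurable (plan @^-1` [set p])) ->
    (forall th p, value r (b1 th) (Tr th) (Zo th) p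
                  <= value r (b1 th) (Tr th) (Zo th) (plan th)) ->
    (* Assumption 1 *)
    0 < alpha ->
    (#|S| <= #|O|)%N ->
    (forall th h, alpha <= sigma_min (obs_matrix (Zo th) h)) ->
    ps_breg r b1 Tr Zo P plan K
    <= C%:R
       * ln (2 + (#|S| * #|A| * #|O| * H * K)%:R / alpha) ^+ c
       * (alpha ^- 2 * (H%:R ^+ 2 * Num.sqrt H%:R) * #|S|%:R ^+ 2
          * Num.sqrt #|A|%:R * (#|O|%:R * Num.sqrt #|O|%:R)
          * Num.sqrt ((1 + #|S|%:R * #|A|%:R / #|O|%:R) * K%:R)).
Proof.
exists 64%N, 1%N => R S A O H K r d T b1 Tr Zo P plan alpha.
move=> r01 b0 bs T0 Ts Z0 Zs mb mT mZ mplan plan_opt al0 SO rv.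
set L := ln _; rewrite expr1.
have L1 : 2^-1 <= L.
  apply: le_trans (ln2_ge_half R) _; rewrite ler_ln ?posrE //; last first.
    by rewrite ltr_wpDr // divr_ge0 // ltW.
  by rewrite lerDl divr_ge0 // ltW.
have rhs0 : 0 <= 64%:R * L * (alpha ^- 2 * (H%:R ^+ 2 * Num.sqrt H%:R) *
    #|S|%:R ^+ 2 * Num.sqrt #|A|%:R * (#|O|%:R * Num.sqrt #|O|%:R) *
    Num.sqrt ((1 + #|S|%:R * #|A|%:R / #|O|%:R) * K%:R)).
  have ia : 0 <= alpha ^- 2 by rewrite invr_ge0 exprn_ge0 // ltW.
  have L0 : 0 <= L by apply: le_trans L1; rewrite invr_ge0.
  by rewrite !mulr_ge0 ?sqrtr_ge0 ?exprn_ge0.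
have [Ic _ _ _] := expectation_Rintegral P.
have zero : (forall th (dat : {ffun 'I_K -> traj A O H * policy A O H}),
    \sum_(k < K) (opt_value r (b1 th) (Tr th) (Zo th) -
                  value r (b1 th) (Tr th) (Zo th) (dat k).2) = 0) ->
    ps_breg r b1 Tr Zo P plan K = 0.
  move=> h; rewrite /ps_breg (_ : (fun th => _) = fun=> 0) ?Ic //.
  by apply/funext => th; rewrite big1 // => dat _; rewrite h mulr0.
(* The passage to histories needs a positive horizon; at horizon 0 all values vanish, and the regret
   with them. *)
case: H => [|H] in r Tr Zo plan r01 T0 Ts Z0 Zs mT mZ mplan plan_opt rv L L1 rhs0 zero *.
  have v0 th p : value r (b1 th) (Tr th) (Zo th) p = 0.
    by rewrite /value big1 // => tau _; rewrite big_ord0 mulr0.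
  rewrite zero // => th dat; rewrite big1 // => k _; rewrite v0 subr0.
  rewrite /opt_value; apply/eqP; rewrite eq_le; apply/andP; split.
    by apply/bigmax_leP; split => // p _; rewrite v0.
  by apply/bigmax_geP; left.
have [K0|K0] := posnP K.
  by rewrite zero // => th dat; rewrite big1 // => -[k kK]; exfalso; rewrite K0 in kK.
(* Inhabitants: the prior has mass 1, [b1] sums to 1, [O] is at least as large as [S], and the
   planner returns an action at the first step. *)
have [t0 _] := probability_inhabited P.
have [s0 _] : exists s : S, True.
  apply: contrapT => nS; have := bs t0; rewrite big1 => [/eqP|s _].
    by rewrite eq_sym oner_eq0.
  by case: nS; exists s.
have S0 : (0 < #|S|)%N by apply/card_gt0P; exists s0.
have O0 : (0 < #|O|)%N by exact: leq_trans SO.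
have [y0 _] : exists y : O, y \in O by apply/card_gt0P.
have [a0 _] : exists a : A, True.
  apply: contrapT => nA.
  by case: nA; exists (plan t0 ord0 ([tuple of [::]], y0)).
have A0 : (0 < #|A|)%N by apply/card_gt0P; exists a0.
have ker th : kernels (b1 th) (Tr th) (Zo th) by split.
have kap := kappa_ge1 s0 (y0, a0) al0 (ker t0) (rv t0).
have sqS : Num.sqrt #|S|%:R <= #|S|%:R :> R.
  have s1 : 1 <= #|S|%:R :> R by rewrite ler1n.
  rewrite -[leRHS]ger0_norm // -sqrtr_sqr ler_sqrt ?sqr_ge0 // expr2.
  by rewrite ler_peMl.
have hL : ln (K * H.+1 * #|O|).+1%:R <= L.
  rewrite ler_ln ?posrE ?ltr0n //; last by rewrite ltr_wpDr // divr_ge0 // ltW.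
  rewrite -natr1 addrC; apply: lerD; first by rewrite ler1n.
  have al_s : alpha <= #|S|%:R.
    by apply: le_trans sqS; move: kap; rewrite ler_pdivlMr // mul1r.
  rewrite ler_pdivlMr // !natrM.
  have -> : #|S|%:R * #|A|%:R * #|O|%:R * H.+1%:R * K%:R =
     K%:R * H.+1%:R * #|O|%:R * (#|A|%:R * #|S|%:R) :> R by ring.
  apply: ler_wpM2l; first by rewrite !mulr_ge0.
  by apply: le_trans al_s _; rewrite ler_peMl // ler1n.
have kap4 : (Num.sqrt #|S|%:R / alpha) ^+ 4 = #|S|%:R ^+ 2 * alpha ^- 4.
  by rewrite exprMn exprVn -[4%N]/(2 * 2)%N exprM sqr_sqrtr.
have natr_ge1 n : (0 < n)%N -> 1 <= n%:R :> R by rewrite ler1n.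
have hJ : 2 + (#|S| + H.+1 * #|S| * #|A| * #|S| + H.+1 * #|S| * #|O|)%:R *
    ln (K * H.+1 * #|O|).+1%:R <=
    2 + (#|S|%:R + H.+1%:R * #|S|%:R * #|A|%:R * #|S|%:R +
         H.+1%:R * #|S|%:R * #|O|%:R) * L.
  by rewrite lerD2l !natrD !natrM ler_wpM2l // !addr_ge0 ?mulr_ge0.
have k0 : 0 < K%:R :> R by rewrite ltr0n.
have [lambda lam0 hlam] := regret_rate (natr_ge1 _ S0) (natr_ge1 _ A0)
  (natr_ge1 _ O0) (natr_ge1 H.+1 isT) k0 al0 (lt_le_trans ltr01 kap) kap4 L1 hJ.
apply: le_trans hlam.
exact: (ps_breg_le P r01 ker mb mT mZ mplan plan_opt s0 (y0, a0) al0 SO rv K0 lam0).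
Qed.
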